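(* Let $A$ and $B$ be nonnegative selfadjoint linear relations in a complex Hilbert space $\mathcal H$, and let $$c_0(A,B):=\mathfrak C\Big(\frac{\mathfrak C(A)+\mathfrak C(B)}2\Big).$$ Then (1) $\mathcal D[c_0(A,B)]=\mathcal D[A]+\mathcal D[B]$; (2) $\operatorname{ran}\big(c_0(A,B)\big)^{1/2}=\operatorname{ran}A^{1/2}+\operatorname{ran}B^{1/2}$; (3) $\mathcal D[A:B]\supseteq\mathcal D[A]+\mathcal D[B]$, and $$h(A,B)\le c_0(A,B)\le\tfrac12(A\dot+B);$$ moreover, the sign ''$=$'' holds (in either of these two inequalities, or between the two outer terms) if and only if $A=B$. In addition, $\operatorname{ran}(A\dot+B)^{1/2}\supseteq\operatorname{ran}A^{1/2}+\operatorname{ran}B^{1/2}$.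
   Context: A linear relation (l.r.) in $\mathcal H$ is a closed linear subspace $A=\{\{f,f'\}\}$ of $\mathcal H\oplus\mathcal H$ (bounded operators are identified with their graphs); $\operatorname{ran}A$ is the set of second components; $\operatorname{mul}A=\{f':\{0,f'\}\in A\}$; $A^{-1}=\{\{f',f\}:\{f,f'\}\in A\}$; $\lambda A=\{\{f,\lambda f'\}\}$. $A$ is selfadjoint if $A=A^*:=\{\{g,g'\}:(f',g)=(f,g')\ \forall\{f,f'\}\in A\}$, nonnegative if $(f',f)\ge0$ for all $\{f,f'\}\in A$. A nonnegative selfadjoint l.r. decomposes as $A=\mathrm{Graph}(A_o)\oplus(\{0\}\oplus\operatorname{mul}A)$ with $A_o$ a nonnegative selfadjoint operator in $\mathcal H\ominus\operatorname{mul}A$. Put $A^{1/2}=\mathrm{Graph}(A_o^{1/2})\oplus(\{0\}\oplus\operatorname{mul}A)$, so $\operatorname{ran}A^{1/2}=\operatorname{ran}A_o^{1/2}\oplus\operatorname{mul}A$. The closed form of $A$ is $A[\varphi]=\|A_o^{1/2}\varphi\|^2$, $\varphi\in\mathcal D[A]=\operatorname{dom}A_o^{1/2}$; this gives a bijection between nonnegative selfadjoint l.r. and closed nonnegative (not necessarily densely defined) forms. The order $A_1\ge A_2$ means $\mathcal D[A_1]\subseteq\mathcal D[A_2]$ and $A_1[\varphi]\ge A_2[\varphi]$ for all $\varphi\in\mathcal D[A_1]$. The form sum $A\dot+B$ is the nonnegative selfadjoint l.r. associated with the closed form $A[\varphi]+B[\varphi]$, $\varphi\in\mathcal D[A]\cap\mathcal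 D[B]$. The parallel sum is $A:B:=(A^{-1}\dot+B^{-1})^{-1}$ and the harmonic mean is $h(A,B):=2(A:B)$. Cayley transform: for a nonnegative selfadjoint l.r. $A$, $\mathfrak C(A)=-I+2(I+A)^{-1}$, a selfadjoint contraction; for a selfadjoint contraction $T$, $\mathfrak C(T)=\{\{(I+T)f,(I-T)f\}:f\in\mathcal H\}$, a nonnegative selfadjoint l.r.; these maps are mutually inverse. *)

(* Defs.v *)
From HB Require Import structures.
From mathcomp Require Import all_boot all_order all_algebra.
From mathcomp Require Import sesquilinear complex.
From mathcomp Require Import all_classical all_reals all_analysis.

Set Implicit Arguments.
Unset Strict Implicit.
Unset Printing Implicit Defensive.

Import Order.TTheory GRing.Theory Num.Theory.
Import numFieldNormedType.Exports.

Local Open Scope classical_set_scope.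
Local Open Scope ring_scope.
Local Open Scope complex_scope.

(* Complex Hilbert spaces: complete normed spaces over R[i] whose norm comes
   from an inner product, linear in its first argument. *)
HB.mixin Record CompleteNormedModule_isHilbert (R : realType) H
    of CompleteNormedModule R[i] H := {
  hdot : {dot H for (@Num.conj R[i])} ;
  hdot_norm : forall x : H, hdot x x = `|x| ^+ 2
}.

#[short(type="hilbertType")]
HB.structure Definition Hilbert (R : realType) :=
  {H of CompleteNormedModule R[i] H & CompleteNormedModule_isHilbert R H}.

Section LinearRelations.
Variables (R : realType) (H : hilbertType R).

Local Notation "''[' u , v ]" := (@hdot R H u v).

Definition lrel := set (H * H).

Implicit Types (A B S T : lrel) (K X Y : set H).

Definition linear_relation A :=
  [/\ closed A, A 0 & forall (a : R[i]) u v, A u -> A v -> A (a *: u + v)].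

Definition lrel_dom A : set H := [set p.1 | p in A].
Definition lrel_ran A : set H := [set p.2 | p in A].
Definition lrel_mul A : set H := [set f' | A (0, f')].
Definition lrel_inv A : lrel := [set p | A (p.2, p.1)].
Definition lrel_scale (a : R[i]) A : lrel := [set (p.1, a *: p.2) | p in A].
Definition lrel_id : lrel := [set p | p.2 = p.1].
Definition lrel_add A B : lrel :=
  [set p | exists f' g', [/\ A (p.1, f'), B (p.1, g') & p.2 = f' + g']].
Definition lrel_comp S T : lrel :=
  [set p | exists g, T (p.1, g) /\ S (g, p.2)].

Definition set_sum X Y : set H := [set x + y | x in X & y in Y].
Definition orthocompl X : set H := [set f | forall g, X g -> '[f, g] = 0].

(* Adjoint relative to a closed subspace K, seen as a Hilbert space; the
   adjoint in the whole space is the case K = setT. *)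
Definition adjoint_in K A : lrel :=
  [set q | [/\ K q.1, K q.2 & forall p, A p -> '[p.2, q.1] = '[p.1, q.2]]].

Definition nonneg_selfadjoint_in K A :=
  [/\ linear_relation A, A = adjoint_in K A & forall p, A p -> 0 <= '[p.2, p.1]].

Definition nonneg_selfadjoint A := nonneg_selfadjoint_in setT A.

(* The graph of A_o, an operator in the orthogonal complement of mul A. *)
Definition op_part A : lrel :=
  A `&` (orthocompl (lrel_mul A) `*` orthocompl (lrel_mul A)).

(* The nonnegative selfadjoint square root of an operator T in K. *)
Definition op_sqrt K T : lrel :=
  xget set0 [set S | [/\ nonneg_selfadjoint_in K S,
                         lrel_mul S `<=` [set 0] & lrel_comp S S = T]].

Definition op_part_sqrt A : lrel :=
  op_sqrt (orthocompl (lrel_mul A)) (op_part A).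

Definition lrel_sqrt A : lrel :=
  [set p + (0, m) | p in op_part_sqrt A & m in lrel_mul A].

Definition op_apply S (f : H) : H := xget 0 [set g | S (f, g)].

Definition lrel_form_dom A : set H := lrel_dom (op_part_sqrt A).

(* The value is a real number, carried in R[i] as norms are. *)
Definition lrel_form A (f : H) : R[i] := `|op_apply (op_part_sqrt A) f| ^+ 2.

Definition lrel_le A B :=
  lrel_form_dom B `<=` lrel_form_dom A /\
  forall f, lrel_form_dom B f -> lrel_form A f <= lrel_form B f.

(* The relation associated with the form A[f] + B[f] on D[A] `&` D[B]. *)
Definition lrel_form_sum A B : lrel :=
  xget set0 [set C | [/\ nonneg_selfadjoint C,
                         lrel_form_dom C = lrel_form_dom A `&` lrel_form_dom B &
                         forall f, lrel_form_dom C f -> lrel_form C f = lrel_form A f + lrel_form B f]].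

Definition lrel_parallel_sum A B : lrel :=
  lrel_inv (lrel_form_sum (lrel_inv A) (lrel_inv B)).

Definition lrel_harmonic_mean A B : lrel := lrel_scale 2 (lrel_parallel_sum A B).

(* The Cayley transform of a nonnegative selfadjoint relation. *)
Definition cayley A : lrel :=
  lrel_add (lrel_scale (-1) lrel_id)
           (lrel_scale 2 (lrel_inv (lrel_add lrel_id A))).

(* The Cayley transform of (the graph of) a selfadjoint contraction. *)
Definition cayley_contraction T : lrel := [set (p.1 + p.2, p.1 - p.2) | p in T].

Definition cayley_mean A B : lrel :=
  cayley_contraction (lrel_scale 2^-1 (lrel_add (cayley A) (cayley B))).

End LinearRelations.

(* Main.v *)
Require Import Defs.
From HB Require Import structures.
From mathcomp Require Import all_boot all_order all_algebra.
From mathcomp Require Import sesquilinear complex.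
From mathcomp Require Import all_classical all_reals all_analysis.
From mathcomp Require Import ring lra.

(* The resolvent P = (I + A)^-1 turns a nonnegative selfadjoint relation into an
   operator 0 <= P <= I, with A = { {P k, k - P k} }.  For p = P^(1/2) and
   q = (I - P)^(1/2) one gets D[A] = ran p, A[p g] + |p g|^2 = |g|^2 for g orthogonal
   to ker p, and ran A^(1/2) = ran q.  By duality, A[f] + |f|^2 is the least c such
   that |(f, k)|^2 <= c (P k, k) for all k; hence A <= B iff P_B <= P_A, and inversion,
   which is P -> I - P, reverses the order.
   As c_0(A, B) has resolvent (P_A + P_B) / 2, claim (1) is the range identity
   ran (S^2 + T^2)^(1/2) = ran S + ran T, and the upper bound in (3) follows from
   Cauchy-Schwarz and duality.  The claims on ran A^(1/2) and on h(A, B) are those on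
   D[A] and on (A + B) / 2 for A^-1 and B^-1. *)

Set Implicit Arguments.
Unset Strict Implicit.
Unset Printing Implicit Defensive.

Import Order.TTheory GRing.Theory Num.Theory.
Import numFieldNormedType.Exports.

Local Open Scope classical_set_scope.
Local Open Scope ring_scope.
Local Open Scope complex_scope.

(** * The real part of the inner product, and its estimates *)

Section RealInnerProduct.
Variables (R : realType) (H : hilbertType R).
Implicit Types (x y z : H) (a b c t : R).

Local Notation "''[' u , v ]" := (@hdot R H u v).

(** The square root of A_o and the form sum are picked by [xget], so nothing can be said about them
    before existence is proved, and for the root also uniqueness. Resolvents move both tasks to
    everywhere defined operators, where symmetry forces linearity and 0 <= T <= I forces continuity.
    Roots of such operators come with the property of commuting with every symmetric operator that
    commutes with T, which takes the place of a functional calculus. Projections, closed ranges and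
    the representation of functionals all come from one minimization argument, [riesz_pair]. Duality
    is preferred to direct work with forms because one estimate gives both membership in a form
    domain and the bound on the value, and because its right-hand side is linear in P, hence suited
    to the mean of two resolvents. For the equality cases, the upper bound is analysed directly; the
    lower one is its image under inversion, and the outer one squeezes c_0. Estimates use the real
    part [rdot], since the order of [R[i]] is only partial. *)

Definition rdot x y : R := complex.Re '[x, y].
Local Notation "<| x , y |>" := (rdot x y).

Definition rnorm x : R := complex.Re `|x|.

Lemma rdotC x y : <|x, y|> = <|y, x|>.
Proof. by rewrite /rdot hermC expr0 mul1r /=; case: '[y, x]. Qed.

Lemma rdotDl x y z : <|x + y, z|> = <|x, z|> + <|y, z|>.
Proof. by rewrite /rdot linearDl raddfD. Qed.

Lemma rdotDr x y z : <|x, y + z|> = <|x, y|> + <|x, z|>.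
Proof. by rewrite /rdot linearDr raddfD. Qed.

Lemma rdotNl x y : <|- x, y|> = - <|x, y|>.
Proof. by rewrite /rdot linearNl raddfN. Qed.

Lemma rdotNr x y : <|x, - y|> = - <|x, y|>.
Proof. by rewrite /rdot linearNr raddfN. Qed.

Lemma rdotBl x y z : <|x - y, z|> = <|x, z|> - <|y, z|>.
Proof. by rewrite rdotDl rdotNl. Qed.

Lemma rdotBr x y z : <|x, y - z|> = <|x, y|> - <|x, z|>.
Proof. by rewrite rdotDr rdotNr. Qed.

Lemma rdot0l x : <|0, x|> = 0.
Proof. by rewrite /rdot linear0l. Qed.

Lemma rdot0r x : <|x, 0|> = 0.
Proof. by rewrite rdotC rdot0l. Qed.

Lemma rdotZl t x y : <|t%:C *: x, y|> = t * <|x, y|>.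
Proof.
have ReM (z : R[i]) : complex.Re (t%:C * z) = t * complex.Re z.
  by case: z => a b /=; rewrite mul0r subr0.
by rewrite /rdot linearZl_LR ReM.
Qed.

Lemma rdotZr t x y : <|x, t%:C *: y|> = t * <|x, y|>.
Proof. by rewrite rdotC rdotZl rdotC. Qed.

Lemma normE x : `|x| = (rnorm x)%:C.
Proof.
by rewrite /rnorm; have := normr_ge0 x; case: `|x| => a b /=; rewrite lecE /= => /andP[/eqP -> _].
Qed.

Lemma rnorm_ge0 x : 0 <= rnorm x.
Proof. by have := normr_ge0 x; rewrite normE lecR. Qed.

Lemma rdotxx x : <|x, x|> = rnorm x ^+ 2.
Proof. by rewrite /rdot hdot_norm normE -rmorphXn. Qed.

Lemma rdot_ge0 x : 0 <= <|x, x|>.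
Proof. by rewrite rdotxx exprn_ge0 ?rnorm_ge0. Qed.

Lemma rnorm_eq0 x : rnorm x = 0 -> x = 0.
Proof. by move=> h; apply/normr0_eq0; rewrite normE h. Qed.

Lemma rdot_eq0 x : <|x, x|> = 0 -> x = 0.
Proof. by rewrite rdotxx => /eqP; rewrite sqrf_eq0 => /eqP /rnorm_eq0. Qed.

Lemma rnormD x y : rnorm (x + y) <= rnorm x + rnorm y.
Proof. by have := ler_normD x y; rewrite !normE -rmorphD lecR. Qed.

Lemma rnormZ t x : rnorm (t%:C *: x) = `|t| * rnorm x.
Proof.
apply: (@complexI R); rewrite rmorphM /= -!normE normrZ; congr (_ * _).
by rewrite normc_def /= expr0n addr0 sqrtr_sqr.
Qed.

Lemma rdotB_sqr x y : <|x - y, x - y|> = <|x, x|> - 2 * <|x, y|> + <|y, y|>.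
Proof. by rewrite !rdotBl !rdotBr (rdotC y x); ring. Qed.

Lemma rdotD_sqr x y : <|x + y, x + y|> = <|x, x|> + 2 * <|x, y|> + <|y, y|>.
Proof. by rewrite !rdotDl !rdotDr (rdotC y x); ring. Qed.

(** The form is conjugate linear in its second argument, so testing against ['i *: y] reads off the
    imaginary part. A complex identity thus becomes two real ones. *)
Lemma hdotE x y : '[x, y] = <|x, y|> +i* <|x, 'i *: y|>.
Proof.
rewrite /rdot linearZr_LR /=; case: '[x, y] => a b /=.
by congr (_ +i* _); rewrite /=; ring.
Qed.

Lemma hdot_eq x y z w : <|x, y|> = <|z, w|> -> <|x, 'i *: y|> = <|z, 'i *: w|> ->
  '[x, y] = '[z, w].
Proof. by rewrite !hdotE => -> ->. Qed.

Lemma hdotZl (a : R[i]) x y : '[a *: x, y] = a * '[x, y].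
Proof. by rewrite linearZl_LR. Qed.

Lemma hdotZr (a : R[i]) x y : '[x, a *: y] = a^*%C * '[x, y].
Proof. by rewrite linearZr_LR. Qed.

Lemma hdotDl x y z : '[x + y, z] = '[x, z] + '[y, z].
Proof. by rewrite linearDl. Qed.

Lemma hdotDr x y z : '[x, y + z] = '[x, y] + '[x, z].
Proof. by rewrite linearDr. Qed.

Lemma rdot_inj x y : (forall z, <|x, z|> = <|y, z|>) -> x = y.
Proof.
move=> h; apply/eqP; rewrite -subr_eq0; apply/eqP/rdot_eq0.
by rewrite rdotBl h subrr.
Qed.

Lemma quad_disc a b c : (forall t, 0 <= a + 2 * b * t + c * t ^+ 2) -> b ^+ 2 <= a * c.
Proof.
move=> h; have a0 : 0 <= a by have := h 0; rewrite !(mulr0, expr0n, addr0) /=.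
have c0 : 0 <= c.
  rewrite leNgt; apply/negP => c0.
  (* Chosen so that t >= 1 and 2 b + c t <= - (1 + a); the polynomial is then at most a - (1 + a) =
     -1. *)
  pose t := (1 + a) + 2 * `|b| / (- c) + (1 + a) / (-c).
  have nc : 0 < - c by rewrite oppr_gt0.
  have h1 : 0 <= `|b| / - c by rewrite divr_ge0 ?normr_ge0 ?ltW.
  have h2 : 0 <= (1 + a) / - c by rewrite divr_ge0 ?ltW //; lra.
  have t1 : 1 <= t by rewrite /t; lra.
  have ct : - c * t = - c * (1 + a) + 2 * `|b| + (1 + a).
    by rewrite /t; field; lra.
  have := h t; have bb := ler_norm b.
  rewrite leNgt => /negP; apply.
  have : 0 <= -c * a by nra.
  have : t * (2 * b + c * t) <= t * (- (1 + a)) by rewrite ler_wpM2l //; nra.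
  nra.
have [c00|cn0] := eqVneq c 0.
  rewrite c00 mulr0; have [->|b0] := eqVneq b 0; first by rewrite expr0n.
  have := h (- (1 + a) / (2 * b)); rewrite c00.
  have -> : a + 2 * b * (- (1 + a) / (2 * b)) + 0 * (- (1 + a) / (2 * b)) ^+ 2 = - 1.
    by field.
  by rewrite oppr_ge0 ler10.
have cp : 0 < c by rewrite lt_neqAle eq_sym cn0.
have := h (- b / c).
have -> : a + 2 * b * (- b / c) + c * (- b / c) ^+ 2 = (a * c - b ^+ 2) / c by field.
by rewrite pmulr_lge0 ?invr_gt0 // subr_ge0.
Qed.

Lemma rdot_CS x y : <|x, y|> ^+ 2 <= <|x, x|> * <|y, y|>.
Proof.
apply: quad_disc => t; have := rdot_ge0 (x + t%:C *: y).
by rewrite rdotD_sqr !rdotZl !rdotZr; congr (0 <= _); ring.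
Qed.

Lemma rdot2_CS x y z w :
  (<|x, z|> + <|y, w|>) ^+ 2 <= (<|x, x|> + <|y, y|>) * (<|z, z|> + <|w, w|>).
Proof.
apply: quad_disc => t.
have := addr_ge0 (rdot_ge0 (x + t%:C *: z)) (rdot_ge0 (y + t%:C *: w)).
by rewrite !rdotD_sqr !rdotZl !rdotZr; congr (0 <= _); ring.
Qed.

Lemma rdot_le_norm x y : `|<|x, y|>| <= rnorm x * rnorm y.
Proof.
rewrite -(@ler_pXn2r _ 2) ?nnegrE ?mulr_ge0 ?rnorm_ge0 //.
by rewrite real_normK ?num_real // exprMn -!rdotxx rdot_CS.
Qed.

Lemma cvg_rnorm (u : nat -> H) x : u @ \oo --> x <-> rnorm (u n - x) @[n --> \oo] --> 0.
Proof.
split=> [/cvgrPdist_lt h|/cvgrPdist_lt h]; apply/cvgrPdist_lt => e e0.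
- have e0' : 0 < e%:C by rewrite ltcR.
  near=> n; rewrite sub0r normrN ger0_norm ?rnorm_ge0 // -ltcR -normE -normrN opprB.
  by near: n; apply: h.
- have eR : e = (complex.Re e)%:C.
    by case: e e0 => a b; rewrite ltcE /= => /andP[/eqP ->].
  have e0' : 0 < complex.Re e by move: e0; rewrite eR ltcR.
  near=> n; rewrite -normrN opprB normE eR ltcR.
  have : `|0 - rnorm (u n - x)| < complex.Re e by near: n; apply: h.
  by rewrite sub0r normrN ger0_norm ?rnorm_ge0.
Unshelve. all: by end_near.
Qed.

Lemma cvg_rdot (u v : nat -> H) x y : u @ \oo --> x -> v @ \oo --> y ->
  <|u n, v n|> @[n --> \oo] --> <|x, y|>.
Proof.
move=> /cvg_rnorm ux /cvg_rnorm vy; apply/subr_cvg0.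
suff h : (rnorm (u n - x) * rnorm (v n - y) + rnorm (u n - x) * rnorm y
     + rnorm x * rnorm (v n - y)) @[n --> \oo] --> (0 : R).
  move: (h) => /cvgN; rewrite oppr0 => hN.
  apply: (squeeze_cvgr _ hN h); apply: nearW => n; rewrite -ler_norml.
  have -> : <|u n, v n|> - <|x, y|> =
     <|u n - x, v n - y|> + <|u n - x, y|> + <|x, v n - y|>.
    by rewrite !rdotBl !rdotBr; ring.
  apply: le_trans (ler_normD _ _) _; apply: lerD; last exact: rdot_le_norm.
  by apply: le_trans (ler_normD _ _) _; apply: lerD; exact: rdot_le_norm.
have -> : (0 : R) = 0 * 0 + 0 * rnorm y + rnorm x * 0 by ring.
apply: cvgD; last by apply: cvgM => //; exact: cvg_cst.
by apply: cvgD; apply: cvgM => //; exact: cvg_cst.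
Qed.

Lemma cvg_rdotl (u : nat -> H) x y : u @ \oo --> x -> <|u n, y|> @[n --> \oo] --> <|x, y|>.
Proof. by move=> ux; apply: cvg_rdot => //; exact: cvg_cst. Qed.

Lemma rdot_cauchy_cvg (u : nat -> H) :
  (forall e, 0 < e -> exists N, forall n m, (N <= n)%N -> (N <= m)%N ->
     <|u n - u m, u n - u m|> < e) -> exists x, u @ \oo --> x.
Proof.
move=> h; suff /cauchy_cvgP /cvg_ex : cauchy (u @ \oo) by [].
apply/cauchyP => e e0.
have eR : e = (complex.Re e)%:C.
  by case: e e0 => a b; rewrite ltcE /= => /andP[/eqP ->].
have e0' : 0 < complex.Re e by move: e0; rewrite eR ltcR.
have [N hN] := h (complex.Re e ^+ 2) ltac:(by rewrite exprn_gt0).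
exists (u N); exists N => // n /= Nn.
rewrite -ball_normE /= normE eR ltcR -(@ltr_pXn2r _ 2) ?nnegrE ?rnorm_ge0 ?ltW //.
by rewrite -rdotxx; apply: hN.
Qed.

End RealInnerProduct.

(** * Symmetric operators and positive contractions *)

Section BoundedOperators.
Variables (R : realType) (H : hilbertType R).
Implicit Types (x y z : H) (t : R) (T S : H -> H).

Local Notation "''[' u , v ]" := (@hdot R H u v).
Local Notation "<| x , y |>" := (rdot x y).

(** Operators are carried as bare functions: symmetry on the whole space already implies linearity,
    by [symm_linear]. *)
Definition symm T := forall x y, '[T x, y] = '[x, T y].

Definition effect T :=
  [/\ symm T, forall x, 0 <= <|T x, x|> & forall x, <|T x, x|> <= <|x, x|>].

Definition opC T : H -> H := fun x => x - T x.

Lemma symm_rdot T : symm T -> forall x y, <|T x, y|> = <|x, T y|>.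
Proof. by move=> sT x y; rewrite /rdot sT. Qed.

Lemma symm_linear T : symm T -> forall (a : R[i]) x y, T (a *: x + y) = a *: T x + T y.
Proof.
move=> sT a x y; apply: rdot_inj => z; rewrite /rdot; congr (complex.Re _).
by rewrite sT linearDl linearZl_LR /= -!sT linearDl linearZl_LR.
Qed.

Lemma symm0 T : symm T -> T 0 = 0.
Proof. by move=> sT; have := symm_linear sT (-1) 0 0; rewrite scaler0 add0r scaleN1r addNr. Qed.

Lemma symmD T : symm T -> {morph T : x y / x + y}.
Proof. by move=> sT x y; have := symm_linear sT 1 x y; rewrite !scale1r. Qed.

Lemma symmZ T : symm T -> forall (a : R[i]) x, T (a *: x) = a *: T x.
Proof. by move=> sT a x; have := symm_linear sT a x 0; rewrite (symm0 sT) !addr0. Qed.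

Lemma symmN T : symm T -> {morph T : x / - x}.
Proof. by move=> sT x; rewrite -scaleN1r (symmZ sT) scaleN1r. Qed.

Lemma symmB T : symm T -> {morph T : x y / x - y}.
Proof. by move=> sT x y; rewrite (symmD sT) (symmN sT). Qed.

Lemma symm_of_rdot T : (forall x y, <|T x, y|> = <|x, T y|>) ->
  (forall x, T ('i *: x) = 'i *: T x) -> symm T.
Proof. by move=> h hi x y; apply: hdot_eq => //; rewrite h hi. Qed.

Lemma symm_comp S T : symm S -> symm T -> (forall x, S (T x) = T (S x)) ->
  symm (fun x => S (T x)).
Proof. by move=> sS sT c x y; apply: etrans (sS _ _) _; rewrite sT c. Qed.

Lemma symm_add S T : symm S -> symm T -> symm (fun x => S x + T x).
Proof. by move=> sS sT x y; rewrite linearDl /= sS sT linearDr. Qed.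

Lemma symm_opC T : symm T -> symm (opC T).
Proof. by move=> sT x y; rewrite /opC linearBl /= sT linearBr. Qed.

Lemma effect_opC T : effect T -> effect (opC T).
Proof.
case=> sT T0 T1; split; first exact: symm_opC.
- by move=> x; rewrite /opC rdotBl subr_ge0.
- by move=> x; rewrite /opC rdotBl gerBl.
Qed.

Lemma opCK T : opC (opC T) = T.
Proof. by apply/funext => x; rewrite /opC subKr. Qed.

Lemma psd_CS T x y : symm T -> (forall x, 0 <= <|T x, x|>) ->
  <|T x, y|> ^+ 2 <= <|T x, x|> * <|T y, y|>.
Proof.
move=> sT T0; apply: quad_disc => t; have := T0 (x + t%:C *: y).
rewrite (symmD sT) (symmZ sT) !(rdotDl, rdotDr, rdotZl, rdotZr) (symm_rdot sT y x) (rdotC y (T x)).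
by congr (0 <= _); ring.
Qed.

Lemma psd_ker T x : symm T -> (forall x, 0 <= <|T x, x|>) -> <|T x, x|> = 0 -> T x = 0.
Proof.
move=> sT T0 h; apply: rdot_eq0; apply/eqP; rewrite -sqrf_eq0 eq_le sqr_ge0 andbT.
by have := psd_CS x (T x) sT T0; rewrite h mul0r.
Qed.

(** Cauchy-Schwarz for the form of T between x and T x gives |T x|^4 <= (T x, x) (T T x, T x), and
    the last factor is at most |T x|^2. *)
Lemma effect_sqr T x : effect T -> <|T x, T x|> <= <|T x, x|>.
Proof.
case=> sT T0 T1; have := psd_CS x (T x) sT T0; have := T1 (T x).
have := T0 x; have := rdot_ge0 (T x).
set a := <|T x, T x|>; set b := <|T x, x|> => a0 b0 h1 h2.
have [->//|an0] := eqVneq a 0.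
have ap : 0 < a by rewrite lt_neqAle eq_sym an0.
by rewrite -(ler_pM2r ap) -expr2 (le_trans h2) // ler_wpM2l.
Qed.

Lemma effect_norm T x : effect T -> rnorm (T x) <= rnorm x.
Proof.
move=> eT; rewrite -(@ler_pXn2r _ 2) ?nnegrE ?rnorm_ge0 // -!rdotxx.
by apply: le_trans (effect_sqr x eT) _; case: eT.
Qed.

Lemma cvg_effect T (u : nat -> H) x : effect T -> u @ \oo --> x ->
  T (u n) @[n --> \oo] --> T x.
Proof.
move=> eT /cvg_rnorm ux; apply/cvg_rnorm.
apply: (squeeze_cvgr _ (@cvg_cst _ _ _ _ _) ux); apply: nearW => n.
have [sT _ _] := eT; by rewrite rnorm_ge0 -(symmB sT) effect_norm.
Qed.

Lemma cvgR_eq (u v : nat -> R) (a b : R) : u n @[n --> \oo] --> a ->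
  v n @[n --> \oo] --> b -> u =1 v -> a = b.
Proof.
move=> ua vb uv; apply: (cvg_unique _ ua); first exact: Rhausdorff.
by have -> : u = v by apply/funext.
Qed.

Lemma cvgR_le (u v : nat -> R) (a b : R) : u n @[n --> \oo] --> a ->
  v n @[n --> \oo] --> b -> (forall n, u n <= v n) -> a <= b.
Proof. by move=> ua vb uv; apply: (ler_cvg_to ua vb); apply: nearW. Qed.

Lemma cvgH_eq (u v : nat -> H) x y : u @ \oo --> x -> v @ \oo --> y -> u =1 v -> x = y.
Proof.
move=> ux vy uv; apply: (cvg_unique _ ux); first exact: norm_hausdorff.
by have -> : u = v by apply/funext.
Qed.

(** * Square root of a positive contraction by iteration *)

Section SquareRoot.
Variable T : H -> H.
Hypothesis eT : effect T.

(* Y solves 2 Y = Y^2 + (1 - T) iff (1 - Y)^2 = T.  The iteration is dominated in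
   norm by the scalar iteration sqrt_bnd, the case T = 0. *)
Fixpoint sqrt_iter n x : H :=
  if n is m.+1 then 2^-1%:C *: (sqrt_iter m (sqrt_iter m x) + opC T x) else 0.

Fixpoint sqrt_bnd n : R := if n is m.+1 then 2^-1 * (sqrt_bnd m ^+ 2 + 1) else 0.

Local Notation Y := sqrt_iter.
Local Notation y_ := sqrt_bnd.

Let sC : symm (opC T). Proof. by apply: symm_opC; case: eT. Qed.

(** Every iterate is a polynomial in T; the symmetry of S is there for its linearity. *)
Lemma sqrt_iter_comm S n : symm S -> (forall x, S (T x) = T (S x)) ->
  forall x, S (Y n x) = Y n (S x).
Proof.
move=> sS c; elim: n => [|n IH] x /=; first exact: symm0.
by rewrite (symmZ sS) (symmD sS) !IH /opC (symmB sS) c.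
Qed.

Lemma symm_sqrt_iter n : symm (Y n).
Proof.
elim: n => [|n IH] x y /=; first by rewrite linear0l linear0r.
by rewrite hdotZl hdotZr conjc_real hdotDl hdotDr !IH sC.
Qed.

Lemma sqrt_iter_ge0 n x : 0 <= <|Y n x, x|>.
Proof.
case: n => [|n] /=; first by rewrite rdot0l.
rewrite rdotZl mulr_ge0 ?invr_ge0 // rdotDl addr_ge0 //.
  by rewrite (symm_rdot (symm_sqrt_iter n)) rdot_ge0.
by case: (effect_opC eT).
Qed.

Lemma sqrt_bnd_itv n : 0 <= y_ n <= 1.
Proof.
elim: n => [|n /andP[h0 h1]] /=; first by rewrite lexx ler01.
have : y_ n ^+ 2 <= 1 by rewrite exprn_ile1.
by have := sqr_ge0 (y_ n); lra.
Qed.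

Lemma sqrt_iter_norm n x : rnorm (Y n x) <= y_ n * rnorm x.
Proof.
elim: n x => [|n IH] x /=; first by rewrite /rnorm normr0 mul0r.
rewrite rnormZ ger0_norm ?invr_ge0 // -mulrA ler_wpM2l ?invr_ge0 //.
apply: le_trans (rnormD _ _) _; rewrite mulrDl mul1r; apply: lerD.
  apply: le_trans (IH _) _; rewrite expr2 -mulrA ler_wpM2l ?IH //.
  by case/andP: (sqrt_bnd_itv n).
exact: effect_norm (effect_opC eT).
Qed.

Lemma sqrt_iter_commY n m x : Y n (Y m x) = Y m (Y n x).
Proof.
apply: sqrt_iter_comm; first exact: symm_sqrt_iter.
by move=> z; rewrite -sqrt_iter_comm //; case: eT.
Qed.

Lemma sqrt_bnd_step n :
  y_ n.+2 - y_ n.+1 = 2^-1 * (y_ n.+1 - y_ n) * (y_ n.+1 + y_ n).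
Proof.
have e m : y_ m.+1 = 2^-1 * (y_ m ^+ 2 + 1) by [].
by rewrite (e n.+1) [X in _ - X = _](e n); field.
Qed.

Lemma sqrt_bnd_incr n : 0 <= y_ n.+1 - y_ n.
Proof.
elim: n => [|n IH]; first by rewrite subr0; case/andP: (sqrt_bnd_itv 1).
rewrite sqrt_bnd_step !mulr_ge0 ?invr_ge0 // addr_ge0 //.
  by case/andP: (sqrt_bnd_itv n.+1).
by case/andP: (sqrt_bnd_itv n).
Qed.

(** Since iterates commute, Y_(n+2) - Y_(n+1) is half of (Y_(n+1) - Y_n) (Y_(n+1) + Y_n), the same
    factorization as in [sqrt_bnd_step], so the scalar bound propagates. *)
Lemma sqrt_iter_step n x : rnorm (Y n.+1 x - Y n x) <= (y_ n.+1 - y_ n) * rnorm x.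
Proof.
elim: n x => [|n IH] x.
  by have := sqrt_iter_norm 1 x; rewrite !subr0.
have -> : Y n.+2 x - Y n.+1 x =
    2^-1%:C *: (Y n.+1 (Y n.+1 x + Y n x) - Y n (Y n.+1 x + Y n x)).
  rewrite (symmD (symm_sqrt_iter n.+1)) (symmD (symm_sqrt_iter n)) (sqrt_iter_commY n n.+1).
  rewrite {1}[Y n.+2]/= -/(Y n.+1) [X in _ - X = _]/= -scalerBr; congr (_ *: _).
  by rewrite [in RHS]opprD [in RHS]addrA addrK opprD addrACA subrr addr0.
rewrite rnormZ ger0_norm ?invr_ge0 // sqrt_bnd_step -!mulrA ler_wpM2l ?invr_ge0 //.
apply: le_trans (IH _) _; rewrite ler_wpM2l //; last first.
  apply: le_trans (rnormD _ _) _; rewrite mulrDl.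
  by apply: lerD; exact: sqrt_iter_norm.
exact: sqrt_bnd_incr.
Qed.

Lemma sqrt_bnd_mono n m : (n <= m)%N -> y_ n <= y_ m.
Proof.
move/subnK <-; elim: (m - n)%N => [|k IH]; first by rewrite add0n.
by rewrite addSn; apply: le_trans IH _; rewrite -subr_ge0; exact: sqrt_bnd_incr.
Qed.

Lemma sqrt_iter_dist n m x : (n <= m)%N ->
  rnorm (Y m x - Y n x) <= (y_ m - y_ n) * rnorm x.
Proof.
move/subnK <-; elim: (m - n)%N => [|k IH].
  by rewrite add0n !subrr mul0r /rnorm normr0.
rewrite addSn -(subrKA (Y (k + n) x)); apply: le_trans (rnormD _ _) _.
rewrite -(subrKA (y_ (k + n)) (y_ (k + n).+1)) mulrDl; apply: lerD => //.
exact: sqrt_iter_step.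
Qed.

Lemma sqrt_bnd_cauchy e : 0 < e -> exists N, forall m, (N <= m)%N -> y_ m - y_ N < e.
Proof.
move=> e0.
have hs : has_sup (range y_).
  split; first by exists (y_ 0%N); exists 0%N.
  by exists 1 => _ [n _ <-]; case/andP: (sqrt_bnd_itv n).
have [_ [N _ <-] hN] := sup_adherent e0 hs.
exists N => m Nm; have := sup_upper_bound hs; move=> /(_ (y_ m)).
have : range y_ (y_ m) by exists m.
by move=> h /(_ h); lra.
Qed.

Lemma sqrt_iter_cvg x : exists z, Y n x @[n --> \oo] --> z.
Proof.
apply: rdot_cauchy_cvg => e e0.
have r0 := rnorm_ge0 x.
have d0 : 0 < (1 + rnorm x) ^+ 2 by rewrite exprn_gt0 // ltr_pwDl.
(* The bound 1 gives d^2 <= d, the division by (1 + |x|)^2 absorbs the norm of x, and the 2 makes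
   the final estimate strict. *)
have [N hN] := sqrt_bnd_cauchy (e := Num.min 1 (e / (1 + rnorm x) ^+ 2 / 2))
   ltac:(by rewrite lt_min ltr01 !divr_gt0).
have key n m : (N <= n)%N -> (n <= m)%N -> <|Y m x - Y n x, Y m x - Y n x|> < e.
  move=> Nn nm; rewrite rdotxx.
  have h1 := sqrt_iter_dist x nm.
  have h2 := hN _ (leq_trans Nn nm).
  have h3 := sqrt_bnd_mono Nn.
  have h4 := sqrt_bnd_mono nm.
  move: h2; rewrite lt_min => /andP[h2 h2'].
  set d := y_ m - y_ n; have d00 : 0 <= d by rewrite subr_ge0.
  have d1 : d < 1 by rewrite /d; lra.
  have d2 : d < e / (1 + rnorm x) ^+ 2 / 2 by rewrite /d; lra.
  apply: (@le_lt_trans _ _ ((d * rnorm x) ^+ 2)).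
    by rewrite ler_pXn2r ?nnegrE ?rnorm_ge0 ?mulr_ge0.
  apply: (@le_lt_trans _ _ (d * (1 + rnorm x) ^+ 2)).
    rewrite exprMn; apply: ler_pM; rewrite ?exprn_ge0 //.
      by rewrite expr2 ler_piMl // ltW.
    by rewrite ler_pXn2r ?nnegrE ?addr_ge0 // lerDr.
  have : d * (1 + rnorm x) ^+ 2 < e / (1 + rnorm x) ^+ 2 / 2 * (1 + rnorm x) ^+ 2.
    by rewrite ltr_pM2r.
  have -> : e / (1 + rnorm x) ^+ 2 / 2 * (1 + rnorm x) ^+ 2 = e / 2.
    by field; lra.
  lra.
exists N => n m Nn Nm; case/orP: (leq_total n m) => nm; last exact: key.
by rewrite -opprB rdotNl rdotNr opprK; exact: key.
Qed.

Lemma effect_sqrt : exists p, [/\ effect p, forall x, p (p x) = T x &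
  forall S, symm S -> (forall x, S (T x) = T (S x)) -> forall x, S (p x) = p (S x)].
Proof.
have [Z hZ] := choice sqrt_iter_cvg.
have cd x z : <|Y n x, z|> @[n --> \oo] --> <|Z x, z|>.
  by apply: cvg_rdot => //; exact: cvg_cst.
have cd' x z : <|x, Y n z|> @[n --> \oo] --> <|x, Z z|>.
  by apply: cvg_rdot => //; exact: cvg_cst.
have Zc S : symm S -> (forall x, S (T x) = T (S x)) -> forall x, S (Z x) = Z (S x).
  move=> sS c x; apply: rdot_inj => z; rewrite (symm_rdot sS).
  apply: (cvgR_eq (cd _ _) (cd _ _)) => n /=.
  by rewrite -(symm_rdot sS) sqrt_iter_comm.
have sZ : symm Z.
  apply: symm_of_rdot => [x y|x].
    by apply: (cvgR_eq (cd _ _) (cd' _ _)) => n; exact: (symm_rdot (symm_sqrt_iter n)).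
  apply: (cvgH_eq (hZ _)); last first.
    by move=> n; rewrite (symmZ (symm_sqrt_iter n)); reflexivity.
  by apply: cvgZr; exact: hZ.
(* The recursion reads Y_n^2 = 2 Y_(n+1) - (I - T). Its limit is taken weakly, with one factor Y_n
   moved to the other side of the inner product; the result says (I - Z)^2 = T. *)
have Z2 x : Z (Z x) = Z x + Z x - opC T x.
  apply: rdot_inj => z; rewrite (symm_rdot sZ).
  apply: (cvgR_eq (cvg_rdot (hZ x) (hZ z))); last first.
    move=> n; rewrite -(symm_rdot (symm_sqrt_iter n)).
    have -> : Y n (Y n x) = Y n.+1 x + Y n.+1 x - opC T x; last reflexivity.
    rewrite /= -scalerDl -rmorphD /= (_ : 2^-1 + 2^-1 = 1 :> R); last by field.
    by rewrite rmorph1 scale1r addrK.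
  rewrite /= in hZ *.
  apply: cvg_rdot; last exact: cvg_cst.
  apply: cvgB; last exact: cvg_cst.
  have h : Y n.+1 x @[n --> \oo] --> Z x by rewrite (cvg_shiftS (fun n => Y n x)).
  by apply: cvgD.
have Z0 x : 0 <= <|Z x, x|>.
  by apply: (cvgR_le (cvg_cst 0) (cd x x)) => n /=; exact: sqrt_iter_ge0.
have Z1 x : <|Z x, x|> <= <|x, x|>.
  apply: (cvgR_le (cd x x) (cvg_cst _)) => n /=.
  apply: le_trans (ler_norm _) _; apply: le_trans (rdot_le_norm _ _) _.
  rewrite rdotxx expr2 ler_wpM2r ?rnorm_ge0 //; apply: le_trans (sqrt_iter_norm _ _) _.
  by rewrite ler_piMl ?rnorm_ge0 //; case/andP: (sqrt_bnd_itv n).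
exists (opC Z); split.
- exact: effect_opC.
- move=> x; rewrite /opC (symmB sZ) Z2 /opC.
  by apply: rdot_inj => z; rewrite !(rdotBl, rdotDl); ring.
- by move=> S sS c x; rewrite /opC (symmB sS) Zc.
Qed.

End SquareRoot.

(** With y = S x - T x, commutation gives (S + T) y = S^2 x - T^2 x = 0. Positivity then yields S y
    = T y = 0, so |y|^2 = (x, S y - T y) = 0. *)
Lemma psd_root_uniq S T : symm S -> symm T -> (forall x, 0 <= <|S x, x|>) ->
  (forall x, 0 <= <|T x, x|>) -> (forall x, S (T x) = T (S x)) ->
  (forall x, S (S x) = T (T x)) -> S =1 T.
Proof.
move=> sS sT S0 T0 c e x; set y := S x - T x.
have h : S y + T y = 0.
  by rewrite /y (symmB sS) (symmB sT) e c addrA subrK subrr.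
have h1 : <|S y, y|> + <|T y, y|> = 0 by rewrite -rdotDl h rdot0l.
have := S0 y; have := T0 y => hT hS.
have Sy : S y = 0 by apply: psd_ker => //; lra.
have Ty : T y = 0 by apply: psd_ker => //; lra.
apply/eqP; rewrite -subr_eq0 -/y; apply/eqP/rdot_eq0.
by rewrite {1}/y rdotBl (symm_rdot sS) (symm_rdot sT) Sy Ty subrr.
Qed.

(** With p the root of T, S T = p S p, because p commutes with S. *)
Lemma effect_comp_ge0 S T x : symm S -> (forall x, 0 <= <|S x, x|>) -> effect T ->
  (forall x, S (T x) = T (S x)) -> 0 <= <|S (T x), x|>.
Proof.
move=> sS S0 eT c; have [p [[sp _ _] pp pc]] := effect_sqrt eT.
rewrite -pp (pc S sS c) (symm_rdot sp); exact: S0.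
Qed.

End BoundedOperators.

(** * Representation of functionals by minimization *)

Section Riesz.
Variables (R : realType) (H : hilbertType R).
Implicit Types (x y z f g : H) (t c : R) (P T S : H -> H) (A : lrel H).

Local Notation "''[' u , v ]" := (@hdot R H u v).
Local Notation "<| x , y |>" := (rdot x y).

Lemma cvg_rdot_cauchy (u : nat -> H) x : u @ \oo --> x -> forall e : R, 0 < e ->
  exists N, forall n m, (N <= n)%N -> (N <= m)%N -> <|u n - u m, u n - u m|> < e.
Proof.
move=> ux e e0.
have h : <|u n - x, u n - x|> @[n --> \oo] --> <|x - x, x - x|>.
  by apply: cvg_rdot; apply: cvgB => //; exact: cvg_cst.
rewrite subrr rdot0l in h; move/cvgrPdist_lt : h => /(_ (e / 4)) [].
  by rewrite divr_gt0.
move=> N _ hN; exists N => n m Nn Nm.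
have hn := hN n Nn; have hm := hN m Nm; rewrite /= !sub0r !normrN !ger0_norm ?rdot_ge0 // in hn hm.
have -> : u n - u m = (u n - x) - (u m - x) by rewrite opprB addrA subrK.
rewrite rdotB_sqr; have := rdot_ge0 ((u n - x) + (u m - x)); rewrite rdotD_sqr.
lra.
Qed.

(* The vectors Phi (k n), Psi (k n) of a minimizing sequence for
   |Phi k|^2 + |Psi k|^2 - 2 phi k converge by the parallelogram law. *)
Lemma riesz_pair (V : lmodType R[i]) (M : set V) (Phi Psi : V -> H) (phi : V -> R) c :
  M 0 -> (forall t v w, M v -> M w -> M (t%:C *: v + w)) ->
  (forall t v w, Phi (t%:C *: v + w) = t%:C *: Phi v + Phi w) ->
  (forall t v w, Psi (t%:C *: v + w) = t%:C *: Psi v + Psi w) ->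
  (forall t v w, phi (t%:C *: v + w) = t * phi v + phi w) ->
  0 <= c ->
  (forall v, M v -> phi v ^+ 2 <= c * (<|Phi v, Phi v|> + <|Psi v, Psi v|>)) ->
  exists (k : nat -> V) (u w : H), [/\ forall n, M (k n), Phi (k n) @[n --> \oo] --> u,
    Psi (k n) @[n --> \oo] --> w,
    forall v, M v -> phi v = <|Phi v, u|> + <|Psi v, w|> &
    <|u, u|> + <|w, w|> <= c].
Proof.
move=> M0 ML PhiL PsiL phiL c0 bnd.
pose q v := <|Phi v, Phi v|> + <|Psi v, Psi v|>.
have q0 v : 0 <= q v by rewrite addr_ge0 ?rdot_ge0.
pose J v := q v - 2 * phi v.
(* If q - 2 phi < - c, then 2 phi exceeds c + q, so 4 phi^2 > (c + q)^2 >= 4 c q, against the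
   hypothesis. *)
have Jlb v : M v -> - c <= J v.
  move=> Mv; have := bnd v Mv; rewrite -/(q v) /J; have := q0 v.
  move: (q v) (phi v) => a b a0 h; rewrite leNgt; apply/negP => hlt.
  have : 0 < (2 * b - (c + a)) * (2 * b + (c + a)) by apply: mulr_gt0; lra.
  by have := sqr_ge0 (c - a); nra.
have JE t v w : J (t%:C *: v + w) = J w + 2 * (<|Phi w, Phi v|> + <|Psi w, Psi v|> - phi v) * t
   + q v * t ^+ 2.
  rewrite /J /q PhiL PsiL phiL !(rdotDl, rdotDr, rdotZl, rdotZr).
  by rewrite (rdotC (Phi v) (Phi w)) (rdotC (Psi v) (Psi w)); ring.
pose E := J @` M.
have hE : has_inf E.
  by split; [exists (J 0); exists 0 | exists (- c) => _ [v Mv <-]; exact: Jlb].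
set m := inf E.
have Jm v : M v -> m <= J v.
  by move=> Mv; apply: ge_inf; [case: hE | exists v].
have kE n : exists v, M v /\ J v < m + n.+1%:R^-1.
  have e0 : 0 < n.+1%:R^-1 :> R by rewrite invr_gt0.
  have [_ [v Mv <-] hv] := inf_adherent e0 hE.
  by exists v.
have [k hk] := choice kE.
have Mk n : M (k n) by case: (hk n).
have dist n l : <|Phi (k n) - Phi (k l), Phi (k n) - Phi (k l)|> +
     <|Psi (k n) - Psi (k l), Psi (k n) - Psi (k l)|> < 2 * (n.+1%:R^-1 + l.+1%:R^-1).
  (* At t = 1/2 the argument is the midpoint of [k n] and [k l], where J is still at least m. *)
  have hd t : m <= J (t%:C *: ((- 1)%:C *: k l + k n) + k l).
    by apply: Jm; apply: (ML) => //; apply: (ML).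
  have := hd 2^-1; have [_] := hk n; have [_] := hk l.
  rewrite (JE 2^-1) /q !PhiL !PsiL phiL.
  have -> : (-1)%:C *: Phi (k l) = - Phi (k l) by rewrite rmorphN1 scaleN1r.
  have -> : (-1)%:C *: Psi (k l) = - Psi (k l) by rewrite rmorphN1 scaleN1r.
  rewrite /J /q ?PhiL ?PsiL ?phiL.
  rewrite !(rdotDl, rdotDr, rdotNl, rdotNr).
  rewrite (rdotC (Phi (k l)) (Phi (k n))) (rdotC (Psi (k l)) (Psi (k n))).
  have -> : 2^-1 ^+ 2 = 4^-1 :> R by field.
  by move: (n.+1%:R^-1) (l.+1%:R^-1) => en el; lra.
have eps0 : (n.+1%:R^-1 : R) @[n --> \oo] --> (0 : R) by exact: cvg_harmonic.
have cau (F : V -> H) : (forall n l, <|F (k n) - F (k l), F (k n) - F (k l)|> <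
     2 * (n.+1%:R^-1 + l.+1%:R^-1)) -> exists u : H, F (k n) @[n --> \oo] --> u.
  move=> hF; apply: (rdot_cauchy_cvg (u := fun n => F (k n))) => e e0.
  move/cvgrPdist_lt : eps0 => /(_ (e / 4)) []; first by rewrite divr_gt0.
  move=> N _ hN; exists N => n l Nn Nl; apply: lt_trans (hF _ _) _.
  have := hN n Nn; have := hN l Nl; rewrite /= !sub0r !normrN !ger0_norm ?invr_ge0 //.
  by move: (n.+1%:R^-1) (l.+1%:R^-1) => en el; lra.
have [u hu] : exists u : H, Phi (k n) @[n --> \oo] --> u.
  apply: cau => n l; apply: le_lt_trans (dist n l).
  by rewrite lerDl rdot_ge0.
have [w hw] : exists w : H, Psi (k n) @[n --> \oo] --> w.
  apply: cau => n l; apply: le_lt_trans (dist n l).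
  by rewrite lerDr rdot_ge0.
(* The point [k n] minimizes J up to 1/(n+1), so moving from it by t v shows in the limit that 2 l t
   + q(v) t^2 >= 0 for all t. The discriminant then forces l = 0. *)
have repr v : M v -> phi v = <|Phi v, u|> + <|Psi v, w|>.
  move=> Mv; pose l := <|u, Phi v|> + <|w, Psi v|> - phi v.
  suff : l ^+ 2 <= 0 * q v.
    rewrite mul0r => l2; have /eqP : l ^+ 2 == 0 by rewrite eq_le l2 sqr_ge0.
    move=> /eqP; rewrite sqrf_eq0 /l => /eqP.
    by rewrite (rdotC u) (rdotC w); lra.
  apply: quad_disc => t; rewrite add0r.
  have h1 : n.+1%:R^-1 + (2 * (<|Phi (k n), Phi v|> + <|Psi (k n), Psi v|> - phi v) * t
     + q v * t ^+ 2) @[n --> \oo] --> 0 + (2 * l * t + q v * t ^+ 2).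
    apply: cvgD => //; apply: cvgD; last exact: cvg_cst.
    apply: cvgMr_tmp; apply: cvgMl_tmp; apply: cvgB; last exact: cvg_cst.
    by apply: cvgD; apply: cvg_rdot => //; exact: cvg_cst.
  rewrite add0r in h1.
  apply: (cvgR_le (cvg_cst 0) h1) => n.
  have := Jm _ (ML t _ _ Mv (Mk n)); rewrite JE; have [_] := hk n.
  by move: (n.+1%:R^-1) => en; lra.
exists k, u, w; split => //.
set s := _ + _.
have s0 : 0 <= s by rewrite addr_ge0 ?rdot_ge0.
(* Both phi and q tend to s along the sequence, so the hypothesis passes to the limit as s^2 <= c
   s. *)
have h1 : phi (k n) @[n --> \oo] --> s.
  have -> : (fun n => phi (k n)) = (fun n => <|Phi (k n), u|> + <|Psi (k n), w|>).
    by apply/funext => n; exact: repr.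
  by apply: cvgD; apply: cvg_rdot => //; exact: cvg_cst.
have h2 : q (k n) @[n --> \oo] --> s by apply: cvgD; exact: cvg_rdot.
have h11 : phi (k n) * phi (k n) @[n --> \oo] --> s * s by exact: cvgM.
have h22 : c * q (k n) @[n --> \oo] --> c * s by apply: cvgM => //; exact: cvg_cst.
have : s * s <= c * s.
  apply: (cvgR_le h11 h22) => n.
  by rewrite -expr2; exact: bnd.
have [->//|sn0] := eqVneq s 0.
by rewrite ler_pM2r // lt_neqAle eq_sym sn0.
Qed.

(** A bound of (f, k) by the form of a^2 + b^2 puts f in ran a + ran b, with control of the
    preimages. The sequence is part of the conclusion because u, as a limit of vectors [a (k n)],
    stays orthogonal to whatever ran a is orthogonal to. *)
Lemma douglas_pair (a b : H -> H) f c : symm a -> symm b -> 0 <= c ->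
  (forall k, <|f, k|> ^+ 2 <= c * (<|a k, a k|> + <|b k, b k|>)) ->
  exists (k : nat -> H) (u w : H), [/\ a (k n) @[n --> \oo] --> u,
    b (k n) @[n --> \oo] --> w, f = a u + b w & <|u, u|> + <|w, w|> <= c].
Proof.
move=> sa sb c0 bnd.
have phiL (t : R) (v w : H) : <|f, t%:C *: v + w|> = t * <|f, v|> + <|f, w|>.
  by rewrite rdotDr rdotZr.
have [k [u [w [_ hu hw repr le]]]] := @riesz_pair H setT a b (rdot f) c I
  (fun _ _ _ _ _ => I) (fun t => symm_linear sa t%:C) (fun t => symm_linear sb t%:C) phiL c0
  (fun v _ => bnd v).
exists k, u, w; split => //; apply: rdot_inj => z.
by rewrite (repr z I) rdotDl (symm_rdot sa u) (symm_rdot sb w) (rdotC u) (rdotC w).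
Qed.

Lemma closed_seq A (u v : nat -> H) x y : closed A -> u @ \oo --> x -> v @ \oo --> y ->
  (forall n, A (u n, v n)) -> A (x, y).
Proof.
move=> cA ux vy h; apply: (closed_cvg A cA _ (x, y) (cvg_pair ux vy)).
exact: nearW.
Qed.

Lemma seq_closed A :
  (forall (u v : nat -> H) x y, u @ \oo --> x -> v @ \oo --> y ->
    (forall n, A (u n, v n)) -> A (x, y)) -> closed A.
Proof.
move=> h [x y] cl.
have hc n : exists p : H * H, [/\ A p, rnorm (p.1 - x) < n.+1%:R^-1 & rnorm (p.2 - y) < n.+1%:R^-1].
  have e0 : 0 < (n.+1%:R^-1)%:C :> R[i] by rewrite ltcR.
  have [] := cl (ball x (n.+1%:R^-1)%:C `*` ball y (n.+1%:R^-1)%:C).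
    by exists (ball x (n.+1%:R^-1)%:C, ball y (n.+1%:R^-1)%:C) => //; split; exact: nbhsx_ballx.
  move=> p [Ap [/= p1 p2]]; exists p; split => //.
    by move: p1; rewrite -ball_normE /= -normrN opprB normE ltcR.
  by move: p2; rewrite -ball_normE /= -normrN opprB normE ltcR.
have [p hp] := choice hc.
have eps0 : (n.+1%:R^-1 : R) @[n --> \oo] --> (0 : R) by exact: cvg_harmonic.
apply: (h (fun n => (p n).1) (fun n => (p n).2)).
- apply/cvg_rnorm; apply: (squeeze_cvgr _ (@cvg_cst _ _ _ _ _) eps0); apply: nearW => n.
  by rewrite rnorm_ge0; case: (hp n) => _ /ltW.
- apply/cvg_rnorm; apply: (squeeze_cvgr _ (@cvg_cst _ _ _ _ _) eps0); apply: nearW => n.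
  by rewrite rnorm_ge0; case: (hp n) => _ _ /ltW.
- by move=> n; rewrite -surjective_pairing; case: (hp n).
Qed.

Lemma orthocompl_cvg (X : set H) (u : nat -> H) x : u @ \oo --> x ->
  (forall n, orthocompl X (u n)) -> orthocompl X x.
Proof.
move=> ux h z Xz.
have lim0 w : (forall n, <|u n, w|> = 0) -> <|x, w|> = 0.
  by move=> uw; apply: (cvgR_eq (cvg_rdotl (y := w) ux) (cvg_cst 0)) => n /=; exact: uw.
have h0 n : <|u n, z|> = 0 /\ <|u n, 'i *: z|> = 0.
  by have := h n z Xz; rewrite hdotE => -[].
by rewrite hdotE !lim0 // => n; case: (h0 n).
Qed.

(** Lets statements about adjoints in an orthogonal complement apply to the whole space. *)
Lemma setT_orthocompl : [set: H] = orthocompl set0.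
Proof. by apply/seteqP; split => // x _ z []. Qed.

End Riesz.

(** * Nonnegative selfadjoint relations and their resolvents *)

Section Resolvent.
Variables (R : realType) (H : hilbertType R).
Implicit Types (x y z f g : H) (t c : R) (P T S : H -> H) (A : lrel H).

Local Notation "''[' u , v ]" := (@hdot R H u v).
Local Notation "<| x , y |>" := (rdot x y).

(* The relation with resolvent (I + A)^-1 = P. *)
Definition rel_of P : lrel H := [set s | P (s.1 + s.2) = s.1].

Lemma rel_of_graph P k : rel_of P (P k, opC P k).
Proof. by rewrite /rel_of /= /opC addrC subrK. Qed.

(** Nonnegativity in [R[i]] includes being real; the symmetry hypothesis supplies that half. *)
Lemma hdot_ge0 x y : '[x, y] = '[y, x] -> 0 <= <|x, y|> -> 0 <= '[x, y].
Proof.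
rewrite !hdotE => -[_ e] h; rewrite lecE /= h andbT; apply/eqP.
have : <|x, 'i *: y|> = - <|y, 'i *: x|>.
  rewrite /rdot hdotZr hermC expr0 mul1r /= hdotZr.
  by case: '[y, x] => a b /=; ring.
by rewrite -e; lra.
Qed.

Lemma rdot_of_ge0 x y : 0 <= '[x, y] -> 0 <= <|x, y|>.
Proof. by rewrite hdotE lecE /= => /andP[]. Qed.

Lemma rdot_i x y : <|'i *: x, y|> = - <|x, 'i *: y|>.
Proof. by rewrite /rdot hdotZl hdotZr; case: '[x, y] => a b /=; ring. Qed.

Lemma adjoint_rdot A x y : (forall p, A p -> A ('i *: p)) ->
  (forall p, A p -> <|p.2, x|> = <|p.1, y|>) ->
  forall p, A p -> '[p.2, x] = '[p.1, y].
Proof.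
move=> iA h p Ap; apply: hdot_eq; first exact: h.
have := h _ (iA p Ap); rewrite /= !rdot_i => e.
by apply: oppr_inj.
Qed.

Lemma orthocompl_lin (X : set H) (a : R[i]) x y :
  orthocompl X x -> orthocompl X y -> orthocompl X (a *: x + y).
Proof. by move=> hx hy z Xz; rewrite hdotDl hdotZl hx // hy // mulr0 addr0. Qed.

(** An adjoint is closed and linear for any [A], so for the relations built below the equality with
    the adjoint also yields [linear_relation]. *)
Lemma adjoint_linear_relation (X : set H) A : linear_relation (adjoint_in (orthocompl X) A).
Proof.
split.
- apply: seq_closed => u v x y ux vy h.
  have hK1 := orthocompl_cvg ux (fun n => let: And3 k _ _ := h n in k).
  have hK2 := orthocompl_cvg vy (fun n => let: And3 _ k _ := h n in k).
  split => // p Ap /=.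
  have e n : '[p.2, u n] = '[p.1, v n] by case: (h n) => _ _ /(_ p Ap).
  have e1 n : <|u n, p.2|> = <|v n, p.1|> by rewrite rdotC (rdotC (v n)) /rdot e.
  have e2 n : <|u n, 'i *: p.2|> = <|v n, 'i *: p.1|>.
    apply: oppr_inj; rewrite -!rdot_i rdotC (rdotC _ p.1) /rdot !hdotZr e //.
  apply: hdot_eq.
    rewrite rdotC (rdotC p.1).
    exact: (cvgR_eq (cvg_rdotl (y := p.2) ux) (cvg_rdotl (y := p.1) vy)).
  rewrite -[LHS]opprK -[RHS]opprK -!rdot_i rdotC (rdotC _ y); congr (- _).
  exact: (cvgR_eq (cvg_rdotl (y := 'i *: p.2) ux) (cvg_rdotl (y := 'i *: p.1) vy)).
- by split=> [z _|z _|p _] /=; rewrite ?linear0l ?linear0r.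
- move=> a u v [u1 u2 u3] [v1 v2 v3]; split; try exact: orthocompl_lin.
  by move=> p Ap; rewrite /= !hdotDr !hdotZr u3 // v3.
Qed.

Lemma lin_rel_sub A p s : linear_relation A -> A p -> A s -> A (p - s).
Proof. by case=> _ _ L Ap As; rewrite addrC -scaleN1r; exact: L. Qed.

Lemma lin_rel_scale A (a : R[i]) p : linear_relation A -> A p -> A (a *: p).
Proof. by case=> _ A0 L Ap; rewrite -[_ *: _]addr0; exact: L. Qed.

Lemma nonneg_rdot (K : set H) A x y : nonneg_selfadjoint_in K A -> A (x, y) -> 0 <= <|y, x|>.
Proof. by case=> _ _ h /h /rdot_of_ge0. Qed.

(* ran (I + A) is closed because |a|^2 + |a'|^2 <= |a + a'|^2 on A, and a vector g
   orthogonal to it gives {g, - g} in A^* = A, so g = 0. *)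
Lemma range_I_plus A f : nonneg_selfadjoint A -> exists x y, A (x, y) /\ x + y = f.
Proof.
move=> nA; have [lA sA pA] := nA; have [cA A0 LA] := lA.
have bnd (v : H * H) : A v -> <|v.1 + v.2, f|> ^+ 2 <=
    <|f, f|> * (<|v.1 + v.2, v.1 + v.2|> + <|0 : H, 0 : H|>).
  by move=> _; rewrite rdot0l addr0 mulrC; exact: rdot_CS.
have phiL (t : R) (v w : H * H) : <|(t%:C *: v + w).1 + (t%:C *: v + w).2, f|> =
    t * <|v.1 + v.2, f|> + <|w.1 + w.2, f|> by rewrite /= !(rdotDl, rdotZl); ring.
have PhiL (t : R) (v w : H * H) : (t%:C *: v + w).1 + (t%:C *: v + w).2 =
    t%:C *: (v.1 + v.2) + (w.1 + w.2) by rewrite /= scalerDr addrACA.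
have PsiL (t : R) (v w : H * H) : 0 = t%:C *: 0 + 0 :> H by rewrite scaler0 addr0.
have [k [u [w [Ak hu _ repr _]]]] := @riesz_pair R H (H * H)%type A (fun v => v.1 + v.2) (fun=> 0)
  (fun v => <|v.1 + v.2, f|>) <|f, f|> A0 (fun t v w => LA t%:C v w) PhiL PsiL phiL
  (rdot_ge0 f) bnd.
have fu : f = u.
  apply/eqP; rewrite -subr_eq0; set g := f - u; apply/eqP.
  have Ag : A (g, - g).
    rewrite sA; split => //; apply: adjoint_rdot; first by move=> p; exact: lin_rel_scale.
    move=> [a b] /repr /=; rewrite rdot0l addr0 rdotNr /g => e.
    by rewrite !rdotBr; move: e; rewrite !rdotDl; lra.
  have := nonneg_rdot nA Ag; rewrite rdotNl => h; apply: rdot_eq0.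
  by have := rdot_ge0 g; lra.
have cau (F : H * H -> H) : (forall n l, <|F (k n) - F (k l), F (k n) - F (k l)|> <=
    <|((k n).1 + (k n).2) - ((k l).1 + (k l).2), ((k n).1 + (k n).2) - ((k l).1 + (k l).2)|>) ->
    exists x : H, F (k n) @[n --> \oo] --> x.
  move=> h; apply: (rdot_cauchy_cvg (u := fun n => F (k n))) => e e0.
  have [N hN] := cvg_rdot_cauchy hu e0; exists N => n l Nn Nl.
  exact: le_lt_trans (h n l) (hN n l Nn Nl).
have hd n l : 0 <= <|(k n).1 - (k l).1, (k n).2 - (k l).2|>.
  by rewrite rdotC; apply: (nonneg_rdot nA); exact: (lin_rel_sub lA (Ak n) (Ak l)).
have dE n l : ((k n).1 + (k n).2) - ((k l).1 + (k l).2) =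
    ((k n).1 - (k l).1) + ((k n).2 - (k l).2) by rewrite opprD addrACA.
have [x hx] : exists x : H, (k n).1 @[n --> \oo] --> x.
  apply: (cau fst) => n l; rewrite dE [leRHS]rdotD_sqr; have := hd n l.
  by have := rdot_ge0 ((k n).2 - (k l).2); lra.
have [y hy] : exists y : H, (k n).2 @[n --> \oo] --> y.
  apply: (cau snd) => n l; rewrite dE [leRHS]rdotD_sqr; have := hd n l.
  by have := rdot_ge0 ((k n).1 - (k l).1); lra.
exists x, y; split.
  by apply: (closed_seq cA hx hy) => n; rewrite -surjective_pairing.
by rewrite fu; apply: (cvgH_eq (cvgD hx hy) hu).
Qed.

Lemma nonneg_selfadjoint_effect A : nonneg_selfadjoint A ->
  exists2 P, effect P & A = rel_of P.
Proof.
move=> nA; have [lA sA pA] := nA.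
have ex f : exists x, A (x, f - x).
  by have [x [y [Axy <-]]] := range_I_plus f nA; exists x; rewrite addrAC subrr add0r.
have [P hP] := choice ex.
have sP : symm P.
  move=> f g; have := hP g; rewrite {1}sA => -[_ _ /(_ _ (hP f))] /=.
  rewrite hdotDl hdotDr -scaleN1r -[X in _ = _ + '[_, X]]scaleN1r hdotZl hdotZr.
  by rewrite rmorphN1 => /addIr ->.
have P1 x : <|P x, P x|> <= <|P x, x|>.
  by have := nonneg_rdot nA (hP x); rewrite rdotBl (rdotC x); lra.
exists P.
  split => // x; first by apply: le_trans (P1 x); exact: rdot_ge0.
  have := P1 x; have := rdot_ge0 (P x - x); rewrite rdotB_sqr; lra.
apply/seteqP; split => -[x y] /=; rewrite /rel_of /=.
  (* Two pairs of A with the same sum of components differ by some {d, - d}, and nonnegativity gives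
     - |d|^2 >= 0. So [P] captures all of A. *)
  move=> Axy; have := lin_rel_sub lA Axy (hP (x + y)).
  set d := (x, y) - _; have -> : d = (x - P (x + y), - (x - P (x + y))).
    congr (_, _) => /=; apply: rdot_inj => z.
    by rewrite !(rdotBl, rdotDl, rdotNl); ring.
  move=> /(nonneg_rdot nA); rewrite rdotNl => h.
  apply/esym/eqP; rewrite -subr_eq0; apply/eqP/rdot_eq0.
  by have := rdot_ge0 (x - P (x + y)); lra.
by move=> e; have := hP (x + y); rewrite e addrAC subrr add0r.
Qed.

Lemma rel_of_param P x y : rel_of P (x, y) -> exists k, x = P k /\ y = opC P k.
Proof. by rewrite /rel_of /opC /= => e; exists (x + y); rewrite e addrAC subrr add0r. Qed.

Lemma opC_comm P x : symm P -> P (opC P x) = opC P (P x).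
Proof. by move=> sP; rewrite /opC (symmB sP). Qed.

Lemma effect_nonneg_selfadjoint P : effect P -> nonneg_selfadjoint (rel_of P).
Proof.
move=> eP; have [sP P0 P1] := eP; have sQ := symm_opC sP.
have com k l : '[opC P k, P l] = '[P k, opC P l].
  by rewrite -sP -sQ opC_comm.
have sA : rel_of P = adjoint_in setT (rel_of P).
  apply/seteqP; split => -[x y] /=.
    move=> /rel_of_param[k [-> ->]]; split => // -[a b] /= /rel_of_param[l [-> ->]]; exact: com.
  move=> [_ _ h]; rewrite /rel_of /=; apply: rdot_inj => z.
  have /(congr1 (@complex.Re R)) := h _ (rel_of_graph P z).
  rewrite /= -!/(rdot _ _) (symm_rdot sQ) (symm_rdot sP) => e.
  move: e; rewrite /opC rdotBr => e.
  by rewrite (symmD sP) rdotDl !(rdotC _ z); lra.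
split => //.
  by rewrite sA setT_orthocompl; exact: adjoint_linear_relation.
move=> [x y] /rel_of_param[k [-> ->]] /=.
apply: hdot_ge0; first by rewrite com.
by rewrite /opC rdotBl subr_ge0 (rdotC k) effect_sqr.
Qed.

End Resolvent.

(** * The square root of a relation and its form, through the resolvent *)

Section Roots.
Variables (R : realType) (H : hilbertType R).
Implicit Types (x y z f g k : H) (t c : R) (P T S p q : H -> H) (A : lrel H).

Local Notation "''[' u , v ]" := (@hdot R H u v).
Local Notation "<| x , y |>" := (rdot x y).

(** The last clause makes [p] and [q] commute with each other, and later with the resolvent of any
    competing square root. *)
Definition sqrt_pair P p q :=
  [/\ effect p, effect q, forall x, p (p x) = P x, forall x, q (q x) = opC P x &
     forall S, symm S -> (forall x, S (P x) = P (S x)) ->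
       (forall x, S (p x) = p (S x)) /\ (forall x, S (q x) = q (S x))].

Lemma effect_sqrt_pair P : effect P -> exists p q, sqrt_pair P p q.
Proof.
move=> eP; have [p [ep pp pc]] := effect_sqrt eP.
have [q [eq qq qc]] := effect_sqrt (effect_opC eP).
exists p, q; split => // S sS c; split; first exact: pc.
by apply: qc => // x; rewrite /opC (symmB sS) c.
Qed.

Lemma hdot_sym0 x y : '[x, y] = 0 -> '[y, x] = 0.
Proof. by move=> h; rewrite hermC expr0 mul1r /= h rmorph0. Qed.

Definition op_space P : set H := orthocompl (lrel_mul (rel_of P)).

Lemma lrel_mul_rel_of P m : lrel_mul (rel_of P) m <-> P m = 0.
Proof. by rewrite /lrel_mul /rel_of /= add0r. Qed.

Section FixedRoots.
Variables P p q : H -> H.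
Hypotheses (eP : effect P) (rt : sqrt_pair P p q).

Local Notation K := (op_space P).

Let sP : symm P. Proof. by case: eP. Qed.
Let ep : effect p. Proof. by case: rt. Qed.
Let eq : effect q. Proof. by case: rt. Qed.
Let sp : symm p. Proof. by case: ep. Qed.
Let sq : symm q. Proof. by case: eq. Qed.
Let pp x : p (p x) = P x. Proof. by case: rt. Qed.
Let qq x : q (q x) = opC P x. Proof. by case: rt. Qed.

Lemma sqrt_pair_comm x : p (q x) = q (p x).
Proof. by case: rt => _ _ _ _ /(_ p sp) []; first by move=> y; rewrite -!pp. Qed.

Lemma sqrt_pair_sum x : p (p x) + q (q x) = x.
Proof. by rewrite pp qq /opC addrC subrK. Qed.

Lemma sqrt_pair_norm x : <|p x, p x|> + <|q x, q x|> = <|x, x|>.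
Proof. by rewrite !(symm_rdot sp, symm_rdot sq) -rdotDr sqrt_pair_sum. Qed.

Lemma root_ker x : P x = 0 <-> p x = 0.
Proof.
split=> [h|h]; last by rewrite -pp h symm0.
by apply: rdot_eq0; rewrite (symm_rdot sp) pp h rdot0r.
Qed.

Lemma op_space_root g : K (p g).
Proof. by move=> z /lrel_mul_rel_of /root_ker pz; rewrite sp pz linear0r. Qed.

Lemma op_space_coroot g : K g -> K (q g).
Proof.
move=> Kg z /lrel_mul_rel_of /root_ker pz; rewrite sq; apply: Kg.
by apply/lrel_mul_rel_of/root_ker; rewrite sqrt_pair_comm pz symm0.
Qed.

Lemma op_space_add x y : K x -> K y -> K (x + y).
Proof. by move=> Kx Ky; rewrite -[x]scale1r; exact: orthocompl_lin. Qed.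

Lemma op_space_sub x y : K x -> K y -> K (x - y).
Proof. by move=> Kx Ky; rewrite addrC -scaleN1r; exact: orthocompl_lin. Qed.

Lemma op_space_ker g : K g -> P g = 0 -> g = 0.
Proof. by move=> Kg Pg; apply: rdot_eq0; rewrite /rdot Kg //; apply/lrel_mul_rel_of. Qed.

(** A substitute for the orthogonal projection on K: u differs from g by an element of ker p = ker
    P. It lies in K because it is a limit of vectors in ran p. *)
Lemma op_space_proj g : exists2 u, K u & p u = p g.
Proof.
have s0 : symm (fun _ : H => 0 : H) by move=> x y; rewrite linear0l linear0r.
have bnd k : <|p g, k|> ^+ 2 <= <|g, g|> * (<|p k, p k|> + <|0 : H, 0 : H|>).
  by rewrite rdot0l addr0 (symm_rdot sp) rdot_CS.
have [k [u [w [hu _ e _]]]] := douglas_pair sp s0 (rdot_ge0 g) bnd.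
exists u; last by rewrite e addr0.
by apply: (orthocompl_cvg hu) => n; exact: op_space_root.
Qed.

(* A_o^(1/2) = { {p g, q g} : g in K }, written without the parameter g = p x + q y. *)
Definition root_rel : lrel H := [set s | [/\ K s.1, K s.2 & q s.1 = p s.2]].

Lemma root_relP x y : root_rel (x, y) <-> exists2 g, K g & x = p g /\ y = q g.
Proof.
split=> [[/= Kx Ky e]|[g Kg [-> ->]]]; last first.
  split; [exact: op_space_root|exact: op_space_coroot|by rewrite sqrt_pair_comm].
exists (p x + q y); first by apply: op_space_add; [exact: op_space_root|exact: op_space_coroot].
rewrite (symmD sp) (symmD sq) sqrt_pair_comm -e sqrt_pair_sum; split => //.
by rewrite -sqrt_pair_comm e sqrt_pair_sum.
Qed.

Lemma root_rel_adjoint : root_rel = adjoint_in K root_rel.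
Proof.
apply/seteqP; split => -[x y].
  move=> [/= Kx Ky e]; split => // -[_ _] /root_relP[g Kg [-> ->]] /=.
  by rewrite sq e sp.
move=> [/= Kx Ky h]; split => //=; apply/eqP; rewrite -subr_eq0; apply/eqP/rdot_eq0.
(* Testing against the element of the root with parameter d = q x - p y turns the adjoint relation
   into (d, q x) = (d, p y), that is |d|^2 = 0. *)
have Kd : K (q x - p y).
  by apply: op_space_sub; [exact: op_space_coroot|exact: op_space_root].
have Rd : root_rel (p (q x - p y), q (q x - p y)) by apply/root_relP; exists (q x - p y).
have /(congr1 (@complex.Re R)) := h _ Rd.
rewrite /= -!/(rdot _ _) (symm_rdot sq) (symm_rdot sp) => e.
by rewrite rdotBr e subrr.
Qed.

Lemma root_rel_comp : lrel_comp root_rel root_rel = op_part (rel_of P).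
Proof.
apply/seteqP; split => -[x z].
  move=> [y /= [[/= Kx Ky e1] [/= _ Kz e2]]]; split => //=.
  by rewrite /rel_of /= (symmD sP) -!pp -e2 sqrt_pair_comm -e1 sqrt_pair_sum.
move=> [/rel_of_param[k [ex ez]] [/= Kx Kz]]; exists (p (q k)); split; split => //=.
- exact: op_space_root.
- by rewrite ex -pp -!sqrt_pair_comm.
- exact: op_space_root.
- by rewrite ez -qq -sqrt_pair_comm.
Qed.

Lemma root_rel_spec : [/\ nonneg_selfadjoint_in K root_rel,
  lrel_mul root_rel `<=` [set 0] & lrel_comp root_rel root_rel = op_part (rel_of P)].
Proof.
split; last exact: root_rel_comp; first split.
- by rewrite root_rel_adjoint; exact: adjoint_linear_relation.
- exact: root_rel_adjoint.
- move=> [_ _] /root_relP[g Kg [-> ->]] /=; apply: hdot_ge0.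
    by rewrite sq sp sqrt_pair_comm.
  have [_ p0 _] := ep; rewrite -(symm_rdot sp).
  by exact: (effect_comp_ge0 g sp p0 eq sqrt_pair_comm).
- move=> y /root_relP[g Kg [/esym/root_ker e ->]].
  by rewrite (op_space_ker Kg e) (symm0 sq).
Qed.

(** Restoring ker P = mul A as multivalued part makes S, selfadjoint only in K, selfadjoint in the
    whole space. It then has a resolvent that can be compared with P. *)
Lemma sqrt_resolvent (S : lrel H) : nonneg_selfadjoint_in K S ->
  nonneg_selfadjoint [set s | exists2 f', S (s.1, f') & P (s.2 - f') = 0].
Proof.
move=> [lS sS pS]; set B := [set s | _].
have SK a b : S (a, b) -> K a /\ K b by rewrite {1}sS => -[].
have ker0 a m : K a -> P m = 0 -> '[a, m] = 0 by move=> Ka Pm; apply: Ka; apply/lrel_mul_rel_of.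
have sB : B = adjoint_in setT B.
  apply/seteqP; split => -[x y].
    move=> [/= y' Sxy Py]; split => // -[a b] /= [b' /= Sab Pb].
    have [Kx _] := SK _ _ Sxy; have [Ka _] := SK _ _ Sab.
    rewrite -(subrK b' b) -(subrK y' y) hdotDl hdotDr (ker0 a _ Ka Py).
    rewrite (hdot_sym0 (ker0 x _ Kx Pb)) !add0r.
    by move: Sxy; rewrite sS => -[_ _ /(_ _ Sab)].
  move=> [_ _ h].
  have Kx : K x.
    move=> m /lrel_mul_rel_of Pm; apply: hdot_sym0.
    rewrite (h (0, m)) ?linear0l //; exists 0; rewrite ?subr0 //.
    by case: lS.
  have [u Ku pu] := op_space_proj y.
  have Pyu : P (y - u) = 0 by rewrite (symmB sP) -!pp pu subrr.
  exists u => //=; rewrite sS; split => // -[a b] Sab.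
  have [Ka _] := SK _ _ Sab.
  have -> : '[(a, b).2, (x, u).1] = '[a, y].
    by apply: (h (a, b)); exists b => //=; rewrite subrr (symm0 sP).
  by rewrite -(subrK u y) hdotDr (ker0 a _ Ka Pyu) add0r.
split => //.
  by rewrite sB setT_orthocompl; exact: adjoint_linear_relation.
move=> [a b] [/= b' Sab Pb]; have [Ka _] := SK _ _ Sab.
rewrite -(subrK b' b) hdotDl (hdot_sym0 (ker0 a _ Ka Pb)) add0r.
exact: (pS _ Sab).
Qed.

(* If r is the resolvent of a square root S then P (r^2 + (1 - r)^2) = r^2,
   so r commutes with P and p (1 - r) = q r by uniqueness of bounded sqrt_pair. *)
Lemma root_rel_uniq (S : lrel H) : nonneg_selfadjoint_in K S ->
  lrel_comp S S = op_part (rel_of P) -> S = root_rel.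
Proof.
move=> nS SS; have [lS sS pS] := nS.
have SK a b : S (a, b) -> K a /\ K b by rewrite {1}sS => -[].
have [r er rE] := nonneg_selfadjoint_effect (sqrt_resolvent nS).
have sr : symm r by case: er.
pose s := opC r; have ss : symm s := symm_opC sr.
have rs x : r (s x) = s (r x) by exact: opC_comm.
have inS x : exists2 f', S (r x, f') & P (s x - f') = 0.
  by have := rel_of_graph r x; rewrite -rE.
pose N x := r (r x) + s (s x).
(* S sends r x to s x up to ker P. Applied twice, it puts {r r x, s s x}, up to ker P, in A_o, whose
   resolvent equation is the claim. *)
have PN x : P (N x) = r (r x).
  have [f1 S1 P1] := inS (r x); have [f2 S2 P2] := inS (s x).
  have e1 : f1 = s (r x).
    apply/esym/eqP; rewrite -subr_eq0; apply/eqP/op_space_ker => //.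
    have [_ ?] := SK _ _ S1; have [? _] := SK _ _ S2.
    by apply: op_space_sub => //; rewrite -rs.
  have : lrel_comp S S (r (r x), f2) by exists f1; split => //; rewrite e1 -rs.
  rewrite SS => -[]; rewrite /rel_of /= => e _.
  have -> : N x = (r (r x) + f2) + (s (s x) - f2).
    by rewrite addrA addrAC addrK.
  by rewrite (symmD sP) P2 addr0.
have sN : symm N by apply: symm_add; apply: symm_comp.
have NP x : N (P x) = r (r x).
  apply: rdot_inj => z; rewrite (symm_rdot sN) (symm_rdot sP) PN.
  by rewrite !(symm_rdot sr).
have Ninj x : N x = 0 -> x = 0.
  move=> e; have : <|r x, r x|> + <|s x, s x|> = 0.
    by rewrite (symm_rdot sr) (symm_rdot ss) -rdotDr -/(N x) e rdot0r.
  have := rdot_ge0 (r x); have := rdot_ge0 (s x) => h1 h2 h3.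
  have rx : r x = 0 by apply: rdot_eq0; lra.
  have : s x = 0 by apply: rdot_eq0; lra.
  by rewrite /s /opC rx subr0.
have Nr x : N (r x) = r (N x) by rewrite /N (symmD sr) !rs.
(* Both N r P and N P r equal r^3, and N is injective. *)
have rP x : r (P x) = P (r x).
  apply/eqP; rewrite -subr_eq0; apply/eqP/Ninj.
  by rewrite (symmB sN) Nr !NP subrr.
have [rp rq] : (forall x, r (p x) = p (r x)) /\ (forall x, r (q x) = q (r x)).
  by case: rt => _ _ _ _ /(_ r sr rP).
have [sp' sq'] : (forall x, s (p x) = p (s x)) /\ (forall x, s (q x) = q (s x)).
  by split=> x; rewrite /s /opC (symmB sp, symmB sq) (rp, rq).
(* The squares are P s^2 and (I - P) r^2, which agree because P (r^2 + s^2) = r^2. *)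
have key : (fun x => p (s x)) =1 (fun x => q (r x)).
  apply: psd_root_uniq.
  - by apply: symm_comp.
  - by apply: symm_comp.
  - by move=> x; case: ep => _ p0 _; apply: (effect_comp_ge0 x sp p0 (effect_opC er)).
  - by move=> x; case: eq => _ q0 _; apply: (effect_comp_ge0 x sq q0 er).
  - by move=> x; rewrite sq' -rs !sqrt_pair_comm rp.
  - move=> x; rewrite sp' rq pp qq /opC -[X in _ = X - _]PN /N (symmD sP).
    by rewrite addrAC subrr add0r.
have sub : S `<=` root_rel.
  move=> [x y] Sxy; have [Kx Ky] := SK _ _ Sxy.
  have : rel_of r (x, y) by rewrite -rE; exists y => //=; rewrite subrr (symm0 sP).
  by move=> /rel_of_param[k [ex ey]]; split => //=; rewrite ex ey; exact: esym (key k).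
(* Adjoints reverse inclusions: S inside [root_rel] gives [root_rel] = its adjoint inside the
   adjoint of S, which is S. *)
apply/seteqP; split => // -[x y] [/= Kx Ky e]; rewrite sS; split => // -[a b] Sab.
have := sub _ Sab.
move=> [/= _ _ ab]; have {e} : root_rel (x, y) by split.
by rewrite {1}root_rel_adjoint => -[_ _ /(_ (a, b))]; apply; split; case: (SK _ _ Sab).
Qed.

Lemma op_part_sqrtE : op_part_sqrt (rel_of P) = root_rel.
Proof.
rewrite /op_part_sqrt /op_sqrt -/(op_space P).
by apply: xget_unique; [exact: root_rel_spec | move=> S [nS _ SS]; exact: root_rel_uniq].
Qed.

Lemma form_dom_rel_of f : lrel_form_dom (rel_of P) f <-> exists2 g, K g & f = p g.
Proof.
rewrite /lrel_form_dom op_part_sqrtE; split.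
  by move=> [[x y] /root_relP[g Kg [/= -> _]] <-]; exists g.
by move=> [g Kg ->]; exists (p g, q g) => //; apply/root_relP; exists g.
Qed.

Lemma form_dom_range : lrel_form_dom (rel_of P) = range p.
Proof.
apply/seteqP; split => [f /form_dom_rel_of[g _ ->]|_ [g _ <-]]; first by exists g.
by have [u Ku <-] := op_space_proj g; apply/form_dom_rel_of; exists u.
Qed.

Lemma lrel_form_rel_of g : K g -> lrel_form (rel_of P) (p g) = (<|q g, q g|>)%:C.
Proof.
move=> Kg; rewrite /lrel_form op_part_sqrtE.
have -> : op_apply root_rel (p g) = q g.
  apply: xget_unique; first by apply/root_relP; exists g.
  move=> y /root_relP[u Ku [pu ->]]; congr (q _); apply/eqP; rewrite -subr_eq0; apply/eqP.
  apply: op_space_ker; first exact: op_space_sub.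
  by apply/root_ker; rewrite (symmB sp) pu subrr.
by rewrite normE -rmorphXn -rdotxx.
Qed.

(** The operator q fixes ker P = mul A, so the multivalued part is absorbed: q K + ker P = q (K +
    ker P). *)
Lemma sqrt_range : lrel_ran (lrel_sqrt (rel_of P)) = range q.
Proof.
(* On ker P one has q^2 m = m, so (q + I) (q m - m) = 0, and q + I is injective since q >= 0. *)
have qker m : P m = 0 -> q m = m.
  move=> Pm; apply/eqP; rewrite -subr_eq0; apply/eqP; set d := q m - m.
  have e : q d + d = 0.
    by rewrite /d (symmB sq) qq /opC Pm subr0 subrKA subrr.
  have : <|q d, d|> + <|d, d|> = 0 by rewrite -rdotDl e rdot0l.
  have q0 : 0 <= <|q d, d|> by case: eq.
  by have := rdot_ge0 d => d0 h; apply: rdot_eq0; lra.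
rewrite /lrel_sqrt op_part_sqrtE; apply/seteqP; split.
  move=> _ [_ [[x y] /root_relP[g Kg [-> ->]] [m /lrel_mul_rel_of Pm <-]] <-] /=.
  by exists (g + m) => //; rewrite (symmD sq) (qker m).
move=> _ [g _ <-]; have [u Ku pu] := op_space_proj g.
have Pm : P (g - u) = 0 by rewrite (symmB sP) -!pp pu subrr.
exists (p u + 0, q u + (g - u)) => /=; last first.
  by rewrite -[g - u in LHS]qker // -(symmD sq) addrC subrK.
exists (p u, q u); first by apply/root_relP; exists u.
by exists (g - u) => //; apply/lrel_mul_rel_of.
Qed.

(** Taking the real part loses nothing, by [lrel_form_real], and the shift by |f|^2 cancels when two
    forms are compared. *)
Definition form_norm A f : R := complex.Re (lrel_form A f) + <|f, f|>.

Lemma form_norm_root g : K g -> form_norm (rel_of P) (p g) = <|g, g|>.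
Proof. by move=> Kg; rewrite /form_norm lrel_form_rel_of //= addrC sqrt_pair_norm. Qed.

End FixedRoots.

Lemma lrel_form_real A f : lrel_form A f = (complex.Re (lrel_form A f))%:C.
Proof. by rewrite /lrel_form normE -rmorphXn. Qed.

Lemma form_norm_ge0 A f : 0 <= form_norm A f.
Proof.
rewrite addr_ge0 ?rdot_ge0 // /lrel_form normE -rmorphXn /=.
by rewrite exprn_ge0 ?rnorm_ge0.
Qed.

Lemma form_norm_dual P f k : effect P -> lrel_form_dom (rel_of P) f ->
  <|f, k|> ^+ 2 <= form_norm (rel_of P) f * <|P k, k|>.
Proof.
move=> eP; have [p [q rt]] := effect_sqrt_pair eP.
move=> /(form_dom_rel_of eP rt)[g Kg ->]; rewrite (form_norm_root eP rt) //.
have [[sp _ _] _ pp _ _] := rt.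
by rewrite -pp !(symm_rdot sp) -(symm_rdot sp k) rdot_CS.
Qed.

(** Here [douglas_pair] with b = 0 writes f = p u with |u|^2 <= c. Domain membership thus follows
    from an estimate, which is how [lrel_le_effect] and [cayley_mean_le] get their domain
    inclusions. *)
Lemma dual_form_norm P f c : effect P -> 0 <= c ->
  (forall k, <|f, k|> ^+ 2 <= c * <|P k, k|>) ->
  lrel_form_dom (rel_of P) f /\ form_norm (rel_of P) f <= c.
Proof.
move=> eP c0 bnd; have [p [q rt]] := effect_sqrt_pair eP.
have [[sp _ _] _ pp _ _] := rt.
have s0 : symm (fun _ : H => 0 : H) by move=> x y; rewrite linear0l linear0r.
have bnd' k : <|f, k|> ^+ 2 <= c * (<|p k, p k|> + <|0 : H, 0 : H|>).
  by rewrite rdot0l addr0 -(symm_rdot sp) pp.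
have [k [u [w [hu _ -> le]]]] := douglas_pair sp s0 c0 bnd'; rewrite addr0.
have Ku : op_space P u by apply: (orthocompl_cvg hu) => n; exact: (op_space_root rt).
split; first by apply/(form_dom_rel_of eP rt); exists u.
by rewrite (form_norm_root eP rt) //; apply: le_trans le; rewrite lerDl rdot_ge0.
Qed.

End Roots.

(** * Order and inversion in terms of resolvents *)

Section Order.
Variables (R : realType) (H : hilbertType R).
Implicit Types (x y z f g k : H) (t c : R) (P Q T p q : H -> H) (A B C S : lrel H).

Local Notation "''[' u , v ]" := (@hdot R H u v).
Local Notation "<| x , y |>" := (rdot x y).

(** The vectors P k give equality in the duality bound, which makes them the test vectors for the
    order and for the equality case. *)
Lemma form_norm_resolvent P k : effect P ->
  lrel_form_dom (rel_of P) (P k) /\ form_norm (rel_of P) (P k) = <|P k, k|>.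
Proof.
move=> eP; have [p [q rt]] := effect_sqrt_pair eP; have [[sp _ _] _ pp _ _] := rt.
have Kpk := op_space_root rt k; rewrite -pp; split.
  by apply/(form_dom_rel_of eP rt); exists (p k).
by rewrite (form_norm_root eP rt) // [RHS](symm_rdot sp).
Qed.

Lemma lrel_leE A B : lrel_le A B <-> lrel_form_dom B `<=` lrel_form_dom A /\
  forall f, lrel_form_dom B f -> form_norm A f <= form_norm B f.
Proof.
have e f : (lrel_form A f <= lrel_form B f) = (form_norm A f <= form_norm B f).
  by rewrite /form_norm lerD2r [in LHS](lrel_form_real A) [in LHS](lrel_form_real B) lecR.
by split=> -[sub h]; split => // f /h; rewrite e.
Qed.

Lemma lrel_le_effect P Q : effect P -> effect Q ->
  lrel_le (rel_of P) (rel_of Q) <-> forall k, <|Q k, k|> <= <|P k, k|>.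
Proof.
move=> eP eQ; rewrite lrel_leE; split.
  (* On f = Q k duality gives (Q k, k)^2 <= A[f]-norm times (P k, k), and that norm is at most (Q k,
     k); one factor cancels. *)
  move=> [sub h] k; have [DQ nQ] := form_norm_resolvent k eQ.
  have := form_norm_dual k eP (sub _ DQ); have := h _ DQ; rewrite nQ.
  have : 0 <= <|Q k, k|> by case: eQ.
  have : 0 <= <|P k, k|> by case: eP.
  move: (form_norm _ _) <|Q k, k|> <|P k, k|> => n b a a0 b0 nb h2.
  have [->//|bn0] := eqVneq b 0.
  have bp : 0 < b by rewrite lt_neqAle eq_sym bn0.
  rewrite -(ler_pM2l bp) -expr2; apply: le_trans h2 _.
  by rewrite ler_wpM2r.
move=> h; have key f : lrel_form_dom (rel_of Q) f ->
    lrel_form_dom (rel_of P) f /\ form_norm (rel_of P) f <= form_norm (rel_of Q) f.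
  move=> Df; apply: dual_form_norm => //; first exact: form_norm_ge0.
  move=> k; apply: le_trans (form_norm_dual k eQ Df) _.
  by rewrite ler_wpM2l ?form_norm_ge0.
by split=> f /key[].
Qed.

(** Both inequalities together make the quadratic form of P - Q vanish, and [psd_ker] turns this
    into P = Q. *)
Lemma lrel_le_anti A B : nonneg_selfadjoint A -> nonneg_selfadjoint B ->
  lrel_le A B -> lrel_le B A -> A = B.
Proof.
move=> /nonneg_selfadjoint_effect[P eP ->] /nonneg_selfadjoint_effect[Q eQ ->].
move=> /(lrel_le_effect eP eQ) h1 /(lrel_le_effect eQ eP) h2; congr (rel_of _).
apply/funext => x; apply/eqP; rewrite -subr_eq0; apply/eqP.
have [sP _ _] := eP; have [sQ _ _] := eQ.
have sD : symm (fun x => P x - Q x).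
  apply: (symm_add sP (T := fun x => - Q x)) => y z.
  by rewrite -scaleN1r hdotZl -[- Q z]scaleN1r hdotZr rmorphN1 sQ.
have D0 y : <|P y - Q y, y|> = 0.
  by rewrite rdotBl; have := h1 y; have := h2 y; lra.
by apply: (psd_ker sD) => // y; rewrite D0.
Qed.

Lemma lrel_inv_rel_of P : symm P -> lrel_inv (rel_of P) = rel_of (opC P).
Proof.
move=> sP; apply/seteqP; split => -[x y]; rewrite /lrel_inv /rel_of /opC /= (addrC y).
  by move=> ->; rewrite addrK.
by move=> /(congr1 (fun z => x + y - z)); rewrite subKr => ->; rewrite addrAC subrr add0r.
Qed.

Lemma nonneg_selfadjoint_inv A : nonneg_selfadjoint A -> nonneg_selfadjoint (lrel_inv A).
Proof.
move=> /nonneg_selfadjoint_effect[P eP ->]; rewrite lrel_inv_rel_of; last by case: eP.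
by apply: effect_nonneg_selfadjoint; exact: effect_opC.
Qed.

Lemma lrel_invK A : lrel_inv (lrel_inv A) = A.
Proof. by apply/seteqP; split => -[x y]. Qed.

Lemma lrel_le_inv A B : nonneg_selfadjoint A -> nonneg_selfadjoint B ->
  lrel_le A B -> lrel_le (lrel_inv B) (lrel_inv A).
Proof.
move=> /nonneg_selfadjoint_effect[P eP ->] /nonneg_selfadjoint_effect[Q eQ ->].
move=> /(lrel_le_effect eP eQ) h; have [sP _ _] := eP; have [sQ _ _] := eQ.
rewrite !lrel_inv_rel_of //; apply/lrel_le_effect; try exact: effect_opC.
by move=> k; rewrite /opC !rdotBl lerD2l lerN2.
Qed.

(* ran A^(1/2) = ran (I - (I + A)^-1)^(1/2) = D[A^-1]. *)
Lemma sqrt_ran_form_dom A : nonneg_selfadjoint A ->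
  lrel_ran (lrel_sqrt A) = lrel_form_dom (lrel_inv A).
Proof.
move=> /nonneg_selfadjoint_effect[P eP ->]; have [sP _ _] := eP.
have [p [q rt]] := effect_sqrt_pair eP; rewrite lrel_inv_rel_of // (sqrt_range eP rt).
have [ep eq pp qq com] := rt.
have rt' : sqrt_pair (opC P) q p.
  split => //; first by move=> x; rewrite opCK pp.
  move=> S sS c; have [] := com S sS; last by [].
  move=> x; have := c x; rewrite /opC (symmB sS).
  by move=> /(congr1 (fun z => S x - z)); rewrite !subKr.
by rewrite (form_dom_range (effect_opC eP) rt').
Qed.

End Order.

(** * Multiplication of a relation by a positive scalar *)

Section Scaling.
Variables (R : realType) (H : hilbertType R).
Implicit Types (x y z f g k : H) (s a : R) (P Q p q : H -> H) (A B C S : lrel H).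

Local Notation "''[' u , v ]" := (@hdot R H u v).
Local Notation "<| x , y |>" := (rdot x y).

Lemma lin_rel_scale_pair (c : R[i]) A x y : linear_relation A -> A (x, y) -> A (c *: x, c *: y).
Proof. exact: lin_rel_scale. Qed.

Lemma lrel_scaleE s A x y : 0 < s -> lrel_scale s%:C A (x, y) <-> A (x, s^-1%:C *: y).
Proof.
move=> s0; have sn0 : s != 0 by rewrite gt_eqF.
have sV z : s%:C *: (s^-1%:C *: z) = z by rewrite scalerA -rmorphM /= divff // scale1r.
have Vs z : s^-1%:C *: (s%:C *: z) = z by rewrite scalerA -rmorphM /= mulVf // scale1r.
split; first by move=> [[u v] /= Auv [<- <-]]; rewrite Vs.
by move=> h; exists (x, s^-1%:C *: y) => //=; rewrite sV.
Qed.

Lemma nonneg_selfadjoint_in_scale (X : set H) s S : 0 < s ->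
  nonneg_selfadjoint_in (orthocompl X) S ->
  nonneg_selfadjoint_in (orthocompl X) (lrel_scale s%:C S).
Proof.
move=> s0 [lS sS pS]; have sn0 : s != 0 by rewrite gt_eqF.
have KZ (a : R[i]) x : orthocompl X x -> orthocompl X (a *: x).
  by move=> Kx z Xz; rewrite hdotZl Kx // mulr0.
have sE : lrel_scale s%:C S = adjoint_in (orthocompl X) (lrel_scale s%:C S).
  apply/seteqP; split => -[x y].
    move=> [[u v] Suv [<- <-]]; move: Suv; rewrite {1}sS => -[/= Ku Kv h].
    split => //=; first exact: KZ.
    by move=> _ [[a b] Sab <-] /=; rewrite hdotZl hdotZr conjc_real (h _ Sab).
  move=> [/= Kx Ky h]; apply/lrel_scaleE => //; rewrite sS; split => //=.
    exact: KZ.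
  move=> [a b] Sab; have := h (a, s%:C *: b) ltac:(by exists (a, b)) => /=.
  rewrite hdotZl hdotZr conjc_real => <-.
  by rewrite mulrA -rmorphM /= mulVf // mul1r.
split => //; first by rewrite sE; exact: adjoint_linear_relation.
move=> _ [[a b] Sab <-] /=; rewrite hdotZl mulr_ge0 //; first by rewrite lecR ltW.
exact: (pS _ Sab).
Qed.

Lemma nonneg_selfadjoint_scale s A : 0 < s -> nonneg_selfadjoint A ->
  nonneg_selfadjoint (lrel_scale s%:C A).
Proof.
by rewrite /nonneg_selfadjoint setT_orthocompl; exact: nonneg_selfadjoint_in_scale.
Qed.

Lemma lrel_mul_scale s A : 0 < s -> nonneg_selfadjoint A ->
  lrel_mul (lrel_scale s%:C A) = lrel_mul A.
Proof.
move=> s0 [lA _ _]; have sn0 : s != 0 by rewrite gt_eqF.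
apply/seteqP; split => y.
  move=> [[u v] Auv /= [u0 <-]]; have := lin_rel_scale_pair s%:C lA Auv.
  by rewrite u0 scaler0.
move=> Ay; exists (0, s^-1%:C *: y) => /=.
  by have := lin_rel_scale_pair s^-1%:C lA Ay; rewrite scaler0.
by rewrite scalerA -rmorphM /= divff // scale1r.
Qed.

(** The relation s A_o^(1/2) is a nonnegative selfadjoint root of s^2 A_o in the same space K, so
    uniqueness of the root identifies it. *)
Lemma op_part_sqrt_scale s A : 0 < s -> nonneg_selfadjoint A ->
  op_part_sqrt (lrel_scale (s * s)%:C A) = lrel_scale s%:C (op_part_sqrt A).
Proof.
move=> s0 nA; have ss0 : 0 < s * s by rewrite mulr_gt0.
have sn0 : s != 0 by rewrite gt_eqF.
have nB := nonneg_selfadjoint_scale ss0 nA.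
have mE := lrel_mul_scale ss0 nA.
have [P eP AE] := nonneg_selfadjoint_effect nA.
have [Q eQ BE] := nonneg_selfadjoint_effect nB.
have [p [q rt]] := effect_sqrt_pair eP.
have [p' [q' rt']] := effect_sqrt_pair eQ.
have KE : op_space P = op_space Q by rewrite /op_space -BE -AE mE.
have [nS _ SS] := root_rel_spec eP rt.
rewrite BE (op_part_sqrtE eQ rt'); symmetry; rewrite AE (op_part_sqrtE eP rt).
apply: (root_rel_uniq eQ rt').
  by rewrite -KE; exact: nonneg_selfadjoint_in_scale.
have lS : linear_relation (root_rel P p q) by case: nS.
have -> : op_part (rel_of Q) = lrel_scale (s * s)%:C (op_part (rel_of P)).
  rewrite /op_part -BE mE -AE; apply/seteqP; split => -[x y].
    move=> [/= h [/= Kx Ky]]; apply/lrel_scaleE => //; split; first exact/lrel_scaleE.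
    by split => //= z mz; rewrite hdotZl Ky // mulr0.
  move=> /(lrel_scaleE _ _ _ ss0)[/= h [/= Kx Ky]]; split; first exact/lrel_scaleE.
  split => //= z mz; have := Ky z mz; rewrite hdotZl => /eqP.
  by rewrite mulf_eq0 (inj_eq (@complexI R) _ 0) invr_eq0 gt_eqF // => /eqP.
rewrite -SS; apply/seteqP; split => -[x z].
  move=> [y [/(lrel_scaleE _ _ _ s0) h1 /(lrel_scaleE _ _ _ s0) h2]].
  apply/lrel_scaleE => //; exists (s^-1%:C *: y); split => //=.
  have := lin_rel_scale_pair s^-1%:C lS h2.
  by rewrite scalerA -rmorphM /= -invfM.
move=> /(lrel_scaleE _ _ _ ss0)[y [h1 h2]]; exists (s%:C *: y); split.
  by exists (x, y).
apply/lrel_scaleE => //=.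
have := lin_rel_scale_pair s%:C lS h2; rewrite scalerA -rmorphM /= invfM mulrA.
by rewrite divff // mul1r.
Qed.

Lemma form_scale a A : 0 < a -> nonneg_selfadjoint A ->
  lrel_form_dom (lrel_scale a%:C A) = lrel_form_dom A /\
  forall f, lrel_form_dom A f -> lrel_form (lrel_scale a%:C A) f = a%:C * lrel_form A f.
Proof.
move=> a0 nA; pose s := Num.sqrt a; have s0 : 0 < s by rewrite sqrtr_gt0.
have aE : a = s * s by rewrite -expr2 sqr_sqrtr ?ltW.
have SE := op_part_sqrt_scale s0 nA; rewrite -aE in SE.
rewrite /lrel_form_dom /lrel_form SE; split.
  apply/seteqP; split => x [[u v]].
    by move=> [[u' v'] S [<- _]] /= <-; exists (u', v').
  by move=> S /= <-; exists (u, s%:C *: v) => //; exists (u, v).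
move=> f [[u v] S /= <-].
have -> : op_apply (lrel_scale s%:C (op_part_sqrt A)) u = s%:C *: op_apply (op_part_sqrt A) u.
  have [P eP AE] := nonneg_selfadjoint_effect nA; have [p [q rt]] := effect_sqrt_pair eP.
  move: S; rewrite AE (op_part_sqrtE eP rt) => S.
  have Sa : root_rel P p q (u, op_apply (root_rel P p q) u).
    by apply: (@xgetPex _ 0 [set g | root_rel P p q (u, g)]); exists v.
  apply: xget_unique; first by exists (u, op_apply (root_rel P p q) u).
  move=> _ [[u' w] Sw [/= uu <-]]; rewrite uu in Sw; congr (_ *: _).
  have [lS _ _] := let: And3 n _ _ := root_rel_spec eP rt in n.
  have [_ mS _] := root_rel_spec eP rt.
  have : root_rel P p q (u - u, w - op_apply (root_rel P p q) u) := lin_rel_sub lS Sw Sa.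
  rewrite subrr => /mS /eqP.
  by rewrite subr_eq0 => /eqP.
rewrite normrZ exprMn aE rmorphM -expr2; congr (_ * _).
by rewrite normc_def /= expr0n addr0 sqrtr_sqr -rmorphXn /= real_normK ?num_real // rmorphXn.
Qed.

Lemma lrel_inv_scale a A : 0 < a -> linear_relation A ->
  lrel_inv (lrel_scale a%:C A) = lrel_scale a^-1%:C (lrel_inv A).
Proof.
move=> a0 lA; have an0 : a != 0 by rewrite gt_eqF.
apply/seteqP; split => -[x y].
  move=> /(lrel_scaleE _ _ _ a0) h; apply/lrel_scaleE; rewrite ?invr_gt0 //.
  rewrite invrK; have := lin_rel_scale_pair a%:C lA h.
  by rewrite scalerA -rmorphM /= divff // scale1r.
move=> /lrel_scaleE; rewrite invr_gt0 invrK => /(_ a0) h; apply/lrel_scaleE => //.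
have := lin_rel_scale_pair a^-1%:C lA h.
by rewrite scalerA -rmorphM /= mulVf // scale1r.
Qed.

End Scaling.

(** * Existence of the form sum *)

Section FormSum.
Variables (R : realType) (H : hilbertType R).
Implicit Types (x y z f g k : H) (t c : R) (A B C : lrel H) (s r : H * H).

Local Notation "''[' u , v ]" := (@hdot R H u v).
Local Notation "<| x , y |>" := (rdot x y).

Section TwoResolvents.
Variables P1 P2 p1 p2 q1 q2 : H -> H.
Hypotheses (eP1 : effect P1) (eP2 : effect P2).
Hypotheses (rt1 : sqrt_pair P1 p1 q1) (rt2 : sqrt_pair P2 p2 q2).

Let ep1 : effect p1. Proof. by case: rt1. Qed.
Let ep2 : effect p2. Proof. by case: rt2. Qed.
Let eq2 : effect q2. Proof. by case: rt2. Qed.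
Let sp1 : symm p1. Proof. by case: ep1. Qed.
Let sp2 : symm p2. Proof. by case: ep2. Qed.
Let sq2 : symm q2. Proof. by case: eq2. Qed.

(* A vector f = p1 x = p2 y of D[A] `&` D[B] is represented by the pair (x, y);
   A[f] + B[f] + |f|^2 is then |x|^2 + |q2 y|^2. *)
Definition sum_dom : set (H * H) :=
  [set s | [/\ op_space P1 s.1, op_space P2 s.2 & p1 s.1 = p2 s.2]].

Definition sum_dot s r : R := <|s.1, r.1|> + <|q2 s.2, q2 r.2|>.

Lemma sum_dom_lin (a : R[i]) s r : sum_dom s -> sum_dom r -> sum_dom (a *: s + r).
Proof.
move=> [s1 s2 se] [r1 r2 re]; split => /=; try exact: orthocompl_lin.
by rewrite (symm_linear sp1) (symm_linear sp2) se re.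
Qed.

Lemma sum_dom0 : sum_dom 0.
Proof. by split=> [z _|z _|] /=; rewrite ?linear0l // (symm0 sp1) (symm0 sp2). Qed.

Lemma sum_domB s r : sum_dom s -> sum_dom r -> sum_dom (s - r).
Proof. by move=> ds dr; rewrite addrC -scaleN1r; exact: sum_dom_lin. Qed.

Lemma sum_dotC s r : sum_dot s r = sum_dot r s.
Proof. by rewrite /sum_dot rdotC [X in _ + X]rdotC. Qed.

Lemma sum_dot_ge0 s : 0 <= sum_dot s s.
Proof. by rewrite addr_ge0 ?rdot_ge0. Qed.

Lemma sum_dotDr s r r' : sum_dot s (r + r') = sum_dot s r + sum_dot s r'.
Proof. by rewrite /sum_dot /= (symmD sq2) !rdotDr addrACA. Qed.

Lemma sum_dotZr t s r : sum_dot s (t%:C *: r) = t * sum_dot s r.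
Proof. by rewrite /sum_dot /= (symmZ sq2) !rdotZr -mulrDr. Qed.

Lemma sum_dotBr s r r' : sum_dot s (r - r') = sum_dot s r - sum_dot s r'.
Proof. by rewrite /sum_dot /= (symmB sq2) !rdotBr; ring. Qed.

Lemma sum_dot_i s r : sum_dot ('i *: s) r = - sum_dot s ('i *: r).
Proof. by rewrite /sum_dot /= !(symmZ sq2) !rdot_i opprD. Qed.

Lemma sum_dot_CS s r : sum_dot s r ^+ 2 <= sum_dot s s * sum_dot r r.
Proof. exact: rdot2_CS. Qed.

Lemma sum_dot_eq0 s : sum_dom s -> sum_dot s s = 0 -> s = 0.
Proof.
case: s => x y [/= Kx Ky e]; rewrite /sum_dot /= => h.
have := rdot_ge0 x; have := rdot_ge0 (q2 y) => h1 h2.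
have x0 : x = 0 by apply: rdot_eq0; lra.
have qy0 : q2 y = 0 by apply: rdot_eq0; lra.
suff -> : y = 0 by rewrite x0.
by rewrite -(sqrt_pair_sum rt2 y) qy0 -e x0 (symm0 sp1) (symm0 sp2) (symm0 sq2) addr0.
Qed.

(** This is closedness of the sum form. The norm controls only x and q2 y, but y = p2 (p1 x) + q2
    (q2 y) recovers y continuously from them. *)
Lemma sum_dom_closed (k : nat -> H * H) u v : (forall n, sum_dom (k n)) ->
  (k n).1 @[n --> \oo] --> u -> q2 (k n).2 @[n --> \oo] --> v ->
  exists2 w, sum_dom (u, w) & q2 w = v.
Proof.
move=> hk hu hv.
have hw : (k n).2 @[n --> \oo] --> p2 (p1 u) + q2 v.
  have -> : (fun n => (k n).2) = (fun n => p2 (p1 (k n).1) + q2 (q2 (k n).2)).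
    by apply/funext => n; case: (hk n) => _ _ ->; rewrite (sqrt_pair_sum rt2).
  by apply: cvgD; apply: cvg_effect => //; apply: cvg_effect.
exists (p2 (p1 u) + q2 v).
  split => /=.
  - by apply: (orthocompl_cvg hu) => n; case: (hk n).
  - by apply: (orthocompl_cvg hw) => n; case: (hk n).
  - apply: (cvgH_eq (cvg_effect ep1 hu) (cvg_effect ep2 hw)) => n.
    by case: (hk n).
by apply: (cvgH_eq (cvg_effect eq2 hw) hv).
Qed.

Lemma sum_riesz k : exists s, sum_dom s /\
  forall r, sum_dom r -> <|p1 r.1, k|> = sum_dot r s.
Proof.
have bnd r : sum_dom r ->
    <|p1 r.1, k|> ^+ 2 <= <|k, k|> * (<|r.1, r.1|> + <|q2 r.2, q2 r.2|>).
  move=> _; apply: le_trans (rdot_CS _ _) _; rewrite mulrC ler_wpM2l ?rdot_ge0 //.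
  apply: (@le_trans _ _ <|r.1, r.1|>); last by rewrite lerDl rdot_ge0.
  by rewrite !rdotxx ler_pXn2r ?nnegrE ?rnorm_ge0 // effect_norm.
have PhiL t (v w : H * H) : (t%:C *: v + w).1 = t%:C *: v.1 + w.1 by [].
have PsiL t (v w : H * H) : q2 (t%:C *: v + w).2 = t%:C *: q2 v.2 + q2 w.2.
  by rewrite /= (symm_linear sq2).
have phiL t (v w : H * H) : <|p1 (t%:C *: v + w).1, k|> = t * <|p1 v.1, k|> + <|p1 w.1, k|>.
  by rewrite /= (symm_linear sp1) rdotDl rdotZl.
have [l [u [w [dl hu hw repr _]]]] := @riesz_pair R H (H * H)%type sum_dom fst (fun r => q2 r.2)
  (fun r => <|p1 r.1, k|>) _ sum_dom0 (fun t v w => sum_dom_lin t%:C (s := v) (r := w))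
  PhiL PsiL phiL (rdot_ge0 k) bnd.
have [y dy qy] := sum_dom_closed dl hu hw.
by exists (u, y); split => // r dr; rewrite (repr r dr) /sum_dot /= qy.
Qed.

(** A representation theorem for the sum form, stated as a duality so that it composes with
    [form_norm_dual] and [dual_form_norm]. *)
Lemma form_sum_effect : exists2 Q, effect Q &
  forall f c, 0 <= c ->
    ((forall k, <|f, k|> ^+ 2 <= c * <|Q k, k|>) <->
     exists2 s, sum_dom s & f = p1 s.1 /\ sum_dot s s <= c).
Proof.
have [Z hZ] := choice sum_riesz.
have dZ k : sum_dom (Z k) by case: (hZ k).
have ZE k r : sum_dom r -> <|p1 r.1, k|> = sum_dot r (Z k) by case: (hZ k) => _; apply.
have Zinj s r : sum_dom s -> sum_dom r ->
    (forall s', sum_dom s' -> sum_dot s' s = sum_dot s' r) -> s = r.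
  move=> ds dr h; apply/eqP; rewrite -subr_eq0; apply/eqP/sum_dot_eq0.
    exact: sum_domB.
  by rewrite sum_dotBr h ?subrr //; exact: sum_domB.
have dsc (a : R[i]) s : sum_dom s -> sum_dom (a *: s).
  by move=> ds; rewrite -[_ *: _]addr0; apply: sum_dom_lin => //; exact: sum_dom0.
have ZL t (v w : H) : Z (t%:C *: v + w) = t%:C *: Z v + Z w.
  apply: Zinj => //; first exact: sum_dom_lin.
  by move=> r dr; rewrite -ZE // sum_dotDr sum_dotZr -!ZE // rdotDr rdotZr.
have Zi v : Z ('i *: v) = 'i *: Z v.
  apply: Zinj => //; first exact: dsc.
  move=> r dr; rewrite -ZE //; apply: oppr_inj; rewrite -sum_dot_i -ZE; last exact: dsc.
  by rewrite /= (symmZ sp1) rdot_i.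
(* With J s = p1 s.1 from [sum_dom] to H, [Z] is the adjoint of J, so Q = J J^*. It is the resolvent
   of the form sum. *)
pose Q k := p1 (Z k).1.
have QE k l : <|Q k, l|> = sum_dot (Z k) (Z l) by rewrite ZE.
have sQ : symm Q.
  apply: symm_of_rdot => [x y|x]; first by rewrite (rdotC x) !QE sum_dotC.
  by rewrite /Q Zi /= (symmZ sp1).
have Q1 k : <|Q k, Q k|> <= <|Q k, k|>.
  rewrite [leRHS]QE; apply: (@le_trans _ _ <|(Z k).1, (Z k).1|>).
    by rewrite /Q !rdotxx ler_pXn2r ?nnegrE ?rnorm_ge0 // effect_norm.
  by rewrite /sum_dot lerDl rdot_ge0.
exists Q.
  split => // k; first by rewrite QE sum_dot_ge0.
  by have := Q1 k; have := rdot_ge0 (Q k - k); rewrite rdotB_sqr; lra.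
move=> f c c0; split; last first.
  move=> [s ds [-> le]] k; rewrite ZE // QE; apply: le_trans (sum_dot_CS _ _) _.
  by rewrite ler_wpM2r ?sum_dot_ge0.
move=> bnd.
have PhiL t (v w : H) : (Z (t%:C *: v + w)).1 = t%:C *: (Z v).1 + (Z w).1 by rewrite ZL.
have PsiL t (v w : H) : q2 (Z (t%:C *: v + w)).2 = t%:C *: q2 (Z v).2 + q2 (Z w).2.
  by rewrite ZL /= (symm_linear sq2).
have phiL t (v w : H) : <|f, t%:C *: v + w|> = t * <|f, v|> + <|f, w|>.
  by rewrite rdotDr rdotZr.
have bnd' v : setT v -> <|f, v|> ^+ 2 <=
    c * (<|(Z v).1, (Z v).1|> + <|q2 (Z v).2, q2 (Z v).2|>).
  by move=> _; have := bnd v; rewrite QE.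
have [l [u [w [_ hu hw repr le]]]] := @riesz_pair R H H setT
  (fun k => (Z k).1) (fun k => q2 (Z k).2) (rdot f) _ I (fun _ _ _ _ _ => I) PhiL PsiL phiL c0 bnd'.
have [y dy qy] := sum_dom_closed (fun n => dZ (l n)) hu hw.
exists (u, y) => //; split; last by rewrite /sum_dot /= qy.
apply: rdot_inj => z; rewrite (repr z I) ZE // /sum_dot /= qy.
by rewrite rdotC (rdotC w).
Qed.

End TwoResolvents.

(** A witness excludes the default value [set0] of [xget]; the later arguments use the form sum only
    through these three clauses. *)
Lemma form_sum_spec A B : nonneg_selfadjoint A -> nonneg_selfadjoint B ->
  [/\ nonneg_selfadjoint (lrel_form_sum A B),
    lrel_form_dom (lrel_form_sum A B) = lrel_form_dom A `&` lrel_form_dom B &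
    forall f, lrel_form_dom (lrel_form_sum A B) f ->
      lrel_form (lrel_form_sum A B) f = lrel_form A f + lrel_form B f].
Proof.
move=> /nonneg_selfadjoint_effect[P1 eP1 ->] /nonneg_selfadjoint_effect[P2 eP2 ->].
rewrite /lrel_form_sum; set X := [set D | _]; suff : X (xget set0 X) by [].
apply: xgetPex.
have [p1 [q1 rt1]] := effect_sqrt_pair eP1; have [p2 [q2 rt2]] := effect_sqrt_pair eP2.
have [Q eQ QE] := form_sum_effect rt1 rt2.
exists (rel_of Q).
(* The two graph norms count |f|^2 twice, hence the extra term on the left. *)
have nrm s : sum_dom P1 P2 p1 p2 s ->
    sum_dot q2 s s + <|p1 s.1, p1 s.1|> =
    form_norm (rel_of P1) (p1 s.1) + form_norm (rel_of P2) (p1 s.1).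
  case=> s1 s2 e; rewrite (form_norm_root eP1 rt1) // e (form_norm_root eP2 rt2) //.
  by rewrite -(sqrt_pair_norm rt2 s.2) /sum_dot; ring.
have domQ f : lrel_form_dom (rel_of Q) f -> exists2 s, sum_dom P1 P2 p1 p2 s &
    f = p1 s.1 /\ sum_dot q2 s s <= form_norm (rel_of Q) f.
  by move=> Df; apply/QE; [exact: form_norm_ge0 | move=> k; exact: form_norm_dual].
split.
- exact: effect_nonneg_selfadjoint.
- apply/seteqP; split => f.
    move=> /domQ[s [s1 s2 e] [-> _]]; split; first by apply/(form_dom_rel_of eP1 rt1); exists s.1.
    by apply/(form_dom_rel_of eP2 rt2); exists s.2.
  move=> [/(form_dom_rel_of eP1 rt1)[x Kx fx] /(form_dom_rel_of eP2 rt2)[y Ky fy]].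
  have ds : sum_dom P1 P2 p1 p2 (x, y) by split => //=; rewrite -fx.
  have h := proj2 (QE f _ (sum_dot_ge0 q2 (x, y))) _.
  by have [] := dual_form_norm eQ (sum_dot_ge0 q2 (x, y))
    (h (ex_intro2 _ _ _ ds (conj fx (lexx _)))).
- move=> f Df; have [s ds [fE le]] := domQ f Df.
  have h := proj2 (QE f _ (sum_dot_ge0 q2 s)) (ex_intro2 _ _ _ ds (conj fE (lexx _))).
  have [_ ge] := dual_form_norm eQ (sum_dot_ge0 q2 s) h.
  have := nrm _ ds; rewrite -fE.
  rewrite (lrel_form_real (rel_of Q)) (lrel_form_real (rel_of P1)) (lrel_form_real (rel_of P2))
    -rmorphD.
  move=> e; congr (_%:C); move: e le ge; rewrite /form_norm; lra.
Qed.

End FormSum.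

(** * The mean c_0 and its comparison with the other two means *)

Section CayleyMean.
Variables (R : realType) (H : hilbertType R).
Implicit Types (x y z f g k : H) (t c : R) (A B C : lrel H) (P Q : H -> H).

Local Notation "''[' u , v ]" := (@hdot R H u v).
Local Notation "<| x , y |>" := (rdot x y).

Definition op_mean P Q : H -> H := fun x => 2^-1%:C *: (P x + Q x).

Lemma rdot_op_mean P Q x y : <|op_mean P Q x, y|> = 2^-1 * (<|P x, y|> + <|Q x, y|>).
Proof. by rewrite /op_mean rdotZl rdotDl. Qed.

Lemma effect_mean P Q : effect P -> effect Q -> effect (op_mean P Q).
Proof.
move=> [sP P0 P1] [sQ Q0 Q1]; split.
- by move=> x y; rewrite hdotZl hdotZr conjc_real hdotDl hdotDr sP sQ.
- by move=> x; rewrite rdot_op_mean; have := P0 x; have := Q0 x; lra.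
- by move=> x; rewrite rdot_op_mean; have := P1 x; have := Q1 x; lra.
Qed.

Lemma halfE : 2^-1 = (2^-1)%:C :> R[i].
Proof. by rewrite fmorphV rmorph_nat. Qed.

Lemma twoE : 2 = 2%:C :> R[i].
Proof. by rewrite rmorph_nat. Qed.

Lemma half_double x : 2^-1%:C *: (x + x) = x.
Proof. by apply: rdot_inj => z; rewrite rdotZl rdotDl; field. Qed.

Lemma cayley_rel_of P x y : cayley (rel_of P) (x, y) <-> y = - x + 2 *: P x.
Proof.
split.
  move=> [f' [g' [[[u v] uv /= [ux <-]] [[a b] ab /= [ax <-]] ->]]].
  rewrite ux in uv; rewrite ax in ab.
  move: uv; rewrite /lrel_id /= => ->; rewrite scaleN1r.
  case: ab => f1 [g1 [fb Ag ea]]; rewrite /lrel_id /= in fb ea.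
  by have -> : P x = b by rewrite ea fb.
move=> ->; exists (- x), (2 *: P x); split => //=.
  by exists (x, x) => //=; rewrite scaleN1r.
exists (x, P x) => //=; exists (P x), (opC P x); split => //=; first exact: rel_of_graph.
by rewrite /opC addrC subrK.
Qed.

(** The averaged contraction is T = 2 M - I with M = [op_mean P Q], so the pair {(I + T) f, (I - T)
    f} is {M k, k - M k} for k = 2 f; this is why half of k serves as witness. *)
Lemma cayley_mean_rel_of P Q : effect P -> effect Q ->
  cayley_mean (rel_of P) (rel_of Q) = rel_of (op_mean P Q).
Proof.
move=> eP eQ; have [sM _ _] := effect_mean eP eQ.
have key k : 2^-1 *: ((- k + 2 *: P k) + (- k + 2 *: Q k)) = P k + Q k - k.
  rewrite halfE twoE; apply: rdot_inj => z.
  by rewrite !(rdotZl, rdotDl, rdotNl); field.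
have keyD k : k + (P k + Q k - k) = P k + Q k by rewrite addrC subrK.
have keyB k : k - (P k + Q k - k) = (k + k) - (P k + Q k) by rewrite opprB addrA.
apply/seteqP; split => -[x y].
  move=> [_ [[k w] [f' [g' [/= /cayley_rel_of -> /cayley_rel_of -> ->]]] <-]] /=.
  move=> [<- <-]; rewrite key keyD keyB /rel_of /= addrC subrK (symmD sM) /op_mean.
  by rewrite -scalerDr half_double.
move=> e; have [k [-> ->]] := rel_of_param e.
exists (2^-1%:C *: k, op_mean P Q k - 2^-1%:C *: k) => /=; last first.
  rewrite addrC subrK /opC; congr (_, _).
  by rewrite opprB addrA -scalerDr half_double.
have [sP _ _] := eP; have [sQ _ _] := eQ.
exists (2^-1%:C *: k, (- (2^-1%:C *: k) + 2 *: P (2^-1%:C *: k)) +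
  (- (2^-1%:C *: k) + 2 *: Q (2^-1%:C *: k))) => /=.
  by eexists; eexists; split; [apply/cayley_rel_of|apply/cayley_rel_of|]; reflexivity.
by rewrite key (symmZ sP) (symmZ sQ) -scalerDr.
Qed.

Lemma cayley_mean_nonneg A B : nonneg_selfadjoint A -> nonneg_selfadjoint B ->
  nonneg_selfadjoint (cayley_mean A B).
Proof.
move=> /nonneg_selfadjoint_effect[P eP ->] /nonneg_selfadjoint_effect[Q eQ ->].
by rewrite cayley_mean_rel_of //; apply/effect_nonneg_selfadjoint/effect_mean.
Qed.

Lemma cayley_mean_inv A B : nonneg_selfadjoint A -> nonneg_selfadjoint B ->
  cayley_mean (lrel_inv A) (lrel_inv B) = lrel_inv (cayley_mean A B).
Proof.
move=> /nonneg_selfadjoint_effect[P eP ->] /nonneg_selfadjoint_effect[Q eQ ->].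
have [sM _ _] := effect_mean eP eQ.
have [sP _ _] := eP; have [sQ _ _] := eQ.
rewrite !lrel_inv_rel_of // !cayley_mean_rel_of ?lrel_inv_rel_of //; try exact: effect_opC.
congr (rel_of _); apply/funext => x; rewrite /op_mean /opC addrACA -opprD.
by rewrite scalerBr half_double.
Qed.

Lemma cayley_mean_id A : nonneg_selfadjoint A -> cayley_mean A A = A.
Proof.
move=> /nonneg_selfadjoint_effect[P eP ->]; rewrite cayley_mean_rel_of //.
by congr (rel_of _); apply/funext => x; rewrite /op_mean half_double.
Qed.

Lemma cayley_mean_form_dom A B : nonneg_selfadjoint A -> nonneg_selfadjoint B ->
  lrel_form_dom (cayley_mean A B) = set_sum (lrel_form_dom A) (lrel_form_dom B).
Proof.
move=> /nonneg_selfadjoint_effect[P eP ->] /nonneg_selfadjoint_effect[Q eQ ->].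
have eM := effect_mean eP eQ; rewrite cayley_mean_rel_of //.
have [p1 [q1 rt1]] := effect_sqrt_pair eP; have [p2 [q2 rt2]] := effect_sqrt_pair eQ.
rewrite (form_dom_range eP rt1) (form_dom_range eQ rt2).
have [[s1 _ _] _ pp1 _ _] := rt1; have [[s2 _ _] _ pp2 _ _] := rt2.
have ME k : <|op_mean P Q k, k|> = 2^-1 * (<|p1 k, p1 k|> + <|p2 k, p2 k|>).
  by rewrite rdot_op_mean -pp1 -pp2 (symm_rdot s1 (p1 k)) (symm_rdot s2 (p2 k)).
apply/seteqP; split => f.
  move=> Df; have bnd k := form_norm_dual k eM Df.
  have bnd' k : <|f, k|> ^+ 2 <=
      form_norm (rel_of (op_mean P Q)) f * 2^-1 * (<|p1 k, p1 k|> + <|p2 k, p2 k|>).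
    by rewrite -mulrA -ME.
  have c0 : 0 <= form_norm (rel_of (op_mean P Q)) f * 2^-1.
    by rewrite mulr_ge0 ?form_norm_ge0.
  have [_ [u [w [_ _ -> _]]]] := douglas_pair s1 s2 c0 bnd'.
  by exists (p1 u); [exists u | exists (p2 w) => //; exists w].
move=> [_ [u _ <-] [_ [w _ <-] <-]].
(* The factor 2 offsets the 1/2 in [ME]. *)
have bnd k : <|p1 u + p2 w, k|> ^+ 2 <= 2 * (<|u, u|> + <|w, w|>) * <|op_mean P Q k, k|>.
  rewrite rdotDl (symm_rdot s1) (symm_rdot s2) ME mulrACA divff ?pnatr_eq0 // mul1r.
  exact: rdot2_CS.
have c0 : 0 <= 2 * (<|u, u|> + <|w, w|>) by rewrite mulr_ge0 // addr_ge0 ?rdot_ge0.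
by case: (dual_form_norm eM c0 bnd).
Qed.

Definition half_sum A B : lrel H := lrel_scale 2^-1 (lrel_form_sum A B).

(** Thanks to the factor 1/2, the two terms |f|^2 average to one, so the identity holds for graph
    norms as well as for forms. *)
Lemma half_sum_spec A B : nonneg_selfadjoint A -> nonneg_selfadjoint B ->
  [/\ nonneg_selfadjoint (half_sum A B),
    lrel_form_dom (half_sum A B) = lrel_form_dom A `&` lrel_form_dom B &
    forall f, lrel_form_dom (half_sum A B) f ->
      form_norm (half_sum A B) f = 2^-1 * (form_norm A f + form_norm B f)].
Proof.
move=> nA nB; have [nC DC FC] := form_sum_spec nA nB.
have h0 : 0 < 2^-1 :> R by rewrite invr_gt0.
have [Dm Fm] := form_scale h0 nC; rewrite /half_sum halfE Dm; split => //.
  exact: nonneg_selfadjoint_scale.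
move=> f Df; rewrite /form_norm Fm // FC //.
by rewrite (lrel_form_real A) (lrel_form_real B) -rmorphD -rmorphM /=; field.
Qed.

Lemma cayley_mean_le A B : nonneg_selfadjoint A -> nonneg_selfadjoint B ->
  lrel_le (cayley_mean A B) (half_sum A B).
Proof.
move=> nA nB; have [_ DE FE] := half_sum_spec nA nB.
have [P eP AE] := nonneg_selfadjoint_effect nA.
have [Q eQ BE] := nonneg_selfadjoint_effect nB.
apply/lrel_leE; suff key f : lrel_form_dom (half_sum A B) f ->
    lrel_form_dom (cayley_mean A B) f /\
    form_norm (cayley_mean A B) f <= form_norm (half_sum A B) f.
  by split=> f /key[].
move=> Df; rewrite FE //; move: Df; rewrite DE => -[DA DB].
rewrite AE BE cayley_mean_rel_of // -AE -BE; apply: dual_form_norm; first exact: effect_mean.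
  by rewrite mulr_ge0 ?invr_ge0 // addr_ge0 ?form_norm_ge0.
move=> k; rewrite rdot_op_mean.
have [p1 [q1 rt1]] := effect_sqrt_pair eP; have [p2 [q2 rt2]] := effect_sqrt_pair eQ.
have [[s1 _ _] _ pp1 _ _] := rt1; have [[s2 _ _] _ pp2 _ _] := rt2.
move: DA DB; rewrite AE BE => /(form_dom_rel_of eP rt1)[x Kx fx] /(form_dom_rel_of eQ rt2)[y Ky fy].
rewrite {2}fx fy (form_norm_root eP rt1) // (form_norm_root eQ rt2) //.
(* Averaging the two expressions of (f, k) gives the constant 1/4 that Cauchy-Schwarz on pairs has
   to match. *)
have e : <|f, k|> = 2^-1 * (<|x, p1 k|> + <|y, p2 k|>).
  by rewrite -(symm_rdot s1) -(symm_rdot s2) -fx -fy; field.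
rewrite -fy e -pp1 -pp2 (symm_rdot s1 (p1 k)) (symm_rdot s2 (p2 k)).
have := rdot2_CS x y (p1 k) (p2 k); nra.
Qed.

(* Testing the equality of the forms on f = (P + Q)/2 k = p1 x = p2 y gives
   |x - p1 k|^2 + |y - p2 k|^2 = 0, hence P k = p1 x = p2 y = Q k. *)
Lemma cayley_mean_eq A B : nonneg_selfadjoint A -> nonneg_selfadjoint B ->
  cayley_mean A B = half_sum A B -> A = B.
Proof.
move=> nA nB; have [_ DE FE] := half_sum_spec nA nB.
have [P eP AE] := nonneg_selfadjoint_effect nA.
have [Q eQ BE] := nonneg_selfadjoint_effect nB.
have [p1 [q1 rt1]] := effect_sqrt_pair eP; have [p2 [q2 rt2]] := effect_sqrt_pair eQ.
have [[s1 _ _] _ pp1 _ _] := rt1; have [[s2 _ _] _ pp2 _ _] := rt2.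
move=> e; rewrite AE BE; congr (rel_of _); apply/funext => k.
have [Df Nf] := form_norm_resolvent k (effect_mean eP eQ).
rewrite -cayley_mean_rel_of // -AE -BE e in Df Nf.
have := FE _ Df; rewrite Nf; move: Df; rewrite DE AE BE.
set f := op_mean P Q k.
move=> [/(form_dom_rel_of eP rt1)[x Kx fx] /(form_dom_rel_of eQ rt2)[y Ky fy]].
rewrite {2}fx fy (form_norm_root eP rt1) // (form_norm_root eQ rt2) // -fy => n.
have ex : <|f, k|> = <|x, p1 k|> by rewrite fx (symm_rdot s1).
have ey : <|f, k|> = <|y, p2 k|> by rewrite fy (symm_rdot s2).
have ek : <|f, k|> = 2^-1 * (<|p1 k, p1 k|> + <|p2 k, p2 k|>).
  by rewrite rdot_op_mean -pp1 -pp2 (symm_rdot s1 (p1 k)) (symm_rdot s2 (p2 k)).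
have := rdot_ge0 (x - p1 k); have := rdot_ge0 (y - p2 k) => h1 h2.
have h3 : <|x - p1 k, x - p1 k|> + <|y - p2 k, y - p2 k|> = 0 by rewrite !rdotB_sqr; lra.
have /eqP : x - p1 k = 0 by apply: rdot_eq0; lra.
have /eqP : y - p2 k = 0 by apply: rdot_eq0; lra.
rewrite !subr_eq0 => /eqP y2 /eqP x1.
by rewrite -pp1 -pp2 -x1 -y2 -fx -fy.
Qed.

Lemma half_sum_id A : nonneg_selfadjoint A -> half_sum A A = A.
Proof.
move=> nA; have [nm DE FE] := half_sum_spec nA nA.
rewrite setIid in DE.
by apply: lrel_le_anti => //; apply/lrel_leE; rewrite DE; split => // f Df;
  rewrite FE ?DE //; lra.
Qed.

(** Twice the inverse of C is the inverse of C / 2, so every claim on h is one on [half_sum] of the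
    inverses. *)
Lemma harmonic_meanE A B : nonneg_selfadjoint A -> nonneg_selfadjoint B ->
  lrel_harmonic_mean A B = lrel_inv (half_sum (lrel_inv A) (lrel_inv B)).
Proof.
move=> nA nB.
have [[lC _ _] _ _] := form_sum_spec (nonneg_selfadjoint_inv nA) (nonneg_selfadjoint_inv nB).
rewrite /half_sum halfE lrel_inv_scale ?invr_gt0 // invrK.
by rewrite /lrel_harmonic_mean /lrel_parallel_sum twoE.
Qed.

Lemma harmonic_mean_le A B : nonneg_selfadjoint A -> nonneg_selfadjoint B ->
  lrel_le (lrel_harmonic_mean A B) (cayley_mean A B).
Proof.
move=> nA nB; have nA' := nonneg_selfadjoint_inv nA; have nB' := nonneg_selfadjoint_inv nB.
rewrite harmonic_meanE // -[X in lrel_le _ X]lrel_invK -cayley_mean_inv //.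
apply: lrel_le_inv; [exact: cayley_mean_nonneg | by case: (half_sum_spec nA' nB') |].
exact: cayley_mean_le.
Qed.

(** Read off from h <= c_0: the domain of c_0 lies in that of h, which is that of A : B since
    scaling keeps form domains. *)
Lemma form_dom_parallel_sum A B : nonneg_selfadjoint A -> nonneg_selfadjoint B ->
  set_sum (lrel_form_dom A) (lrel_form_dom B) `<=` lrel_form_dom (lrel_parallel_sum A B).
Proof.
move=> nA nB.
have [nC _ _] := form_sum_spec (nonneg_selfadjoint_inv nA) (nonneg_selfadjoint_inv nB).
have [<- _] := form_scale (ltr0Sn R 1) (nonneg_selfadjoint_inv nC).
by rewrite -cayley_mean_form_dom // -twoE; case: (harmonic_mean_le nA nB).
Qed.

End CayleyMean.

Theorem theorem5p4 (R : realType) (H : hilbertType R) (A B : lrel H)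
    (hA : nonneg_selfadjoint A) (hB : nonneg_selfadjoint B) :
  let c0 := cayley_mean A B in
  let h := lrel_harmonic_mean A B in
  let m := lrel_scale 2^-1 (lrel_form_sum A B) in
  [/\ lrel_form_dom c0 = set_sum (lrel_form_dom A) (lrel_form_dom B),
      lrel_ran (lrel_sqrt c0) =
        set_sum (lrel_ran (lrel_sqrt A)) (lrel_ran (lrel_sqrt B)),
      [/\ set_sum (lrel_form_dom A) (lrel_form_dom B) `<=` lrel_form_dom (lrel_parallel_sum A B),
          lrel_le h c0 /\ lrel_le c0 m &
          [/\ h = c0 <-> A = B, c0 = m <-> A = B & h = m <-> A = B]] &
      set_sum (lrel_ran (lrel_sqrt A)) (lrel_ran (lrel_sqrt B)) `<=`
        lrel_ran (lrel_sqrt (lrel_form_sum A B))].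
Proof.
move=> c0 h m.
have nA' := nonneg_selfadjoint_inv hA; have nB' := nonneg_selfadjoint_inv hB.
have nc0 : nonneg_selfadjoint c0 := cayley_mean_nonneg hA hB.
have hc0 : lrel_le h c0 := harmonic_mean_le hA hB.
have c0m : lrel_le c0 m := cayley_mean_le hA hB.
have [nm _ _] := half_sum_spec hA hB.
have c0_eq : c0 = m -> A = B := cayley_mean_eq hA hB.
split.
- exact: cayley_mean_form_dom.
- by rewrite !sqrt_ran_form_dom // -cayley_mean_inv // cayley_mean_form_dom.
- split; [exact: form_dom_parallel_sum | by [] |]; split; split.
  (* Inverting h = c_0 gives the upper equality for the inverses of A and B, which are therefore
     equal. *)
  + rewrite /h harmonic_meanE // => e; rewrite -(lrel_invK A) -(lrel_invK B); congr lrel_inv.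
    apply: cayley_mean_eq => //.
    by rewrite cayley_mean_inv // -/c0 -e lrel_invK.
  + move=> AB; rewrite /h /c0 harmonic_meanE // -AB half_sum_id ?cayley_mean_id ?lrel_invK //.
  + exact: c0_eq.
  + by move=> AB; rewrite /m -/(half_sum A B) /c0 -AB half_sum_id // cayley_mean_id.
  (* If h = m, then m = h <= c_0 <= m, and antisymmetry reduces to the previous case. *)
  + by move=> e; apply: c0_eq; apply: lrel_le_anti => //; rewrite -e.
  + move=> AB; rewrite /h harmonic_meanE // /m -/(half_sum A B) -AB !half_sum_id // lrel_invK //.
- have [nC _ _] := form_sum_spec hA hB.
  (* The inverse of the form sum of A and B is the parallel sum of their inverses, so the domain
     inclusion in (3) applies to these. *)
  rewrite !sqrt_ran_form_dom //; have := form_dom_parallel_sum nA' nB'.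
  by rewrite /lrel_parallel_sum !lrel_invK.
Qed.
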